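(* For $h\ge1$ let $\Delta_h=\sum_{W}p_h^U(W)\,\|W\|$ be the expected displacement of a growing self-avoiding walk on $\mathcal G_h$ starting at $(0,h-1)$ under the uniform model, the sum being over all GSAWs on $\mathcal G_h$ starting at $(0,h-1)$. Then $$\Delta_3=\frac{3013}{389},\qquad \Delta_4=\frac{163501511557499670817}{20874575314535639327},$$ and $\Delta_5$ is a rational number whose value rounded to 10 decimal places is $8.0835861225$.
   Context: $\mathcal G_h$ is the half-infinite grid graph with vertex set $\mathbb N\times\{0,\dots,h-1\}$ ($0\in\mathbb N$), with an edge between two points exactly when they are at Euclidean distance $1$. A growing self-avoiding walk (GSAW) is a finite directed walk that visits no vertex twice and whose final vertex is trapped, i.e. all of its neighbors are visited by the walk. $\|W\|$ is the displacement of $W$: the difference between the largest and smallest $x$-coordinates of its vertices. Uniform model: at each step the next vertex is chosen uniformly at random among the not-yet-visited neighbors of the current endpoint; $p_h^U(W)$ is the product over the steps of $W$ of $1/m$, where $m$ is the number of unvisited neighbors of the current endpoint just before that step. *)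

(* Defs.v *)
From HB Require Import structures.
From mathcomp Require Import all_boot all_order all_algebra.
From mathcomp Require Import all_classical all_reals all_analysis.
From mathcomp Require Import zify.
Set Implicit Arguments.
Unset Strict Implicit.
Unset Printing Implicit Defensive.
Import Order.TTheory GRing.Theory Num.Theory.
Local Open Scope ring_scope.

Definition point := (nat * nat)%type.

Definition grid (h : nat) (u : point) : bool := (u.2 < h)%N.

(* Square of the Euclidean distance: for lattice points it is an integer, and
   it equals 1 exactly when the distance does. *)
Definition sqdist (u v : point) : int :=
  (u.1%:Z - v.1%:Z) ^+ 2 + (u.2%:Z - v.2%:Z) ^+ 2.

Definition adj (h : nat) : rel point :=
  fun u v => [&& grid h u, grid h v & sqdist u v == 1].

(* The search box is large enough to contain every neighbour: see mem_nbrs. *)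
Definition nbrs (h : nat) (u : point) : seq point :=
  [seq v <- [seq (x, y) | x <- iota 0 u.1.+2, y <- iota 0 h] | adj h u v].

Lemma mem_nbrs (h : nat) (u v : point) : (v \in nbrs h u) = adj h u v.
Proof.
rewrite mem_filter andb_idr //.
case: u v => [a b] [c d] /and3P[_]; rewrite /grid /sqdist.
rewrite [(a, b).1]/= [(a, b).2]/= [(c, d).1]/= [(c, d).2]/= => dh /eqP e.
have := sqr_ge0 (b%:Z - d%:Z); move: e; rewrite !expr2 => e e'.
by apply: allpairs_f; rewrite mem_iota add0n //=; nia.
Qed.

Lemma nbrs_uniq (h : nat) (u : point) : uniq (nbrs h u).
Proof.
by rewrite filter_uniq // allpairs_uniq ?iota_uniq // => -[? ?] [? ?] _ _.
Qed.

(* A walk is the sequence of the vertices it visits, in order. *)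
Definition endpoint (W : seq point) : point := last (0, 0)%N W.

Definition walk (h : nat) (W : seq point) : bool :=
  if W is v :: p then grid h v && path (adj h) v p else false.

Definition unvisited_nbrs (h : nat) (W : seq point) : seq point :=
  [seq v <- nbrs h (endpoint W) | v \notin W].

Definition trapped (h : nat) (W : seq point) : bool :=
  all [in W] (nbrs h (endpoint W)).

Definition gsaw (h : nat) (W : seq point) : bool :=
  [&& walk h W, uniq W & trapped h W].

Definition displacement (W : seq point) : nat :=
  let M := (\max_(v <- W) v.1)%N in
  (* M is an upper bound, hence neutral for the minimum over W *)
  (M - \big[minn/M]_(v <- W) v.1)%N.

(* Step i goes from the endpoint of take i.+1 W to the next vertex of W. *)
Definition uniform_weight (R : realType) (h : nat) (W : seq point) : R :=
  \prod_(i < (size W).-1) (size (unvisited_nbrs h (take i.+1 W)))%:R^-1.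

Definition gsaws_from (h : nat) (v : point) : set (seq point) :=
  [set W | gsaw h W /\ ohead W = Some v].

(* A sum of nonnegative terms, with values in the extended reals. *)
Definition expected_displacement (R : realType) (h : nat) : \bar R :=
  \esum_(W in gsaws_from h (0, h.-1)%N)
    (uniform_weight R h W * (displacement W)%:R)%:E.

(* Rounding to d decimal places (half up). *)
Definition round_dec (d : nat) (x : rat) : rat :=
  (Num.floor (x * 10 ^+ d + 2^-1))%:~R / 10 ^+ d.

(* Main.v *)
Require Import Defs.
From Stdlib Require Import BinNat FMapPositive.
From mathcomp Require Import all_boot all_order all_algebra.
From mathcomp Require Import all_classical all_reals all_analysis.
From mathcomp Require Import zify ring lra.
Set Implicit Arguments.
Unset Strict Implicit.
Unset Printing Implicit Defensive.
Import Order.TTheory GRing.Theory Num.Theory.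
Import numFieldNormedType.Exports.
Local Open Scope ring_scope.

(* The displacement of a walk that starts in column 0 is the number of k >= 1 such
   that it reaches column k, so the expected displacement is the sum over k >= 1 of
   the probability A_k to reach column k, provided A_k tends to 0: then almost every
   walk gets trapped.

   A_k is computed by removing the columns one at a time from the left.  Across the
   cut between two neighbouring columns, a walk is described by a finite history:
   the rows at which it crosses, with the occupancies of the two columns at those
   times.  These suffice to know the number of unvisited neighbours at each step, so
   the weight of a walk to the right of a cut depends on its left part only through
   the history of the cut.  Hence A_k = e_x E^k u, where the finite matrix E, indexed
   by the histories, is obtained by simulating the walk in a single column.

   An integral weight w with E w + 1 <= w on the histories reachable from the start
   shows that 1 - E is invertible over the rationals, that E^k tends to 0, and that
   the exact solution of v = u + E v differs by at most delta * w from any v with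
   residual at most delta.  For h = 3 and h = 4 the tables contain the exact
   solution, for h = 5 an approximation of it. *)

(** * Histories of a cut *)

(* A column is given by the occupancy of its rows. *)
Definition column := seq bool.

Fixpoint mark (D : column) (y : nat) : column :=
  match D, y with
  | [::], _ => [::]
  | _ :: D', 0 => true :: D'
  | b :: D', y'.+1 => b :: mark D' y'
  end.

(* The rows out of range count as occupied. *)
Definition occ (D : column) (y : nat) : bool := nth true D y.

Fixpoint supersets (D : column) : seq column :=
  match D with
  | [::] => [:: [::]]
  | b :: D' =>
      let s := supersets D' in
      if b then map (cons true) s else map (cons false) s ++ map (cons true) s
  end.

(* [(V, y, z, C)], seen from the right of a cut between two columns: the walk
   crosses leftwards at row y, when the right column has occupancy V, and comes
   back at row z, the left column then having occupancy C. *)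
Definition crossing := (column * nat * nat * column)%type.
(* [(C, y, t)]: the walk has just crossed a cut for the first time, at row y, with
   occupancy C of the left column, and t lists its later returns to the left. *)
Definition state := (column * nat * seq crossing)%type.

(* The weights are kept integral by scaling each step by 12. *)
Definition share (m : nat) : N :=
  match m with 1 => 12%num | 2 => 6%num | 3 => 4%num | 4 => 3%num | _ => 0%num end.

Definition below (D : column) (y : nat) : bool :=
  if y is y'.+1 then ~~ occ D y' else false.

(* The walk has just moved from column D to the next column, whose occupancy is now
   Vp: either it never comes back, or it comes back at an unknown row y, the next
   column then having an unknown occupancy V. *)
Definition continuations
    (E : column -> column -> nat -> seq crossing -> seq (N * state))
    (k : nat) (D Vp : column) (sc : seq crossing) : seq (N * seq crossing) :=
  (if sc is [::] then [:: (iter k (N.mul 12) 1%num, [::])] else [::]) ++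
  flatten [seq flatten [seq
      [seq (p.1, (V, y, p.2.1.2, p.2.1.1) :: p.2.2) | p <- E (mark D y) V y sc]
    | V <- supersets (mark Vp y)] | y <- iota 0 (size D) & ~~ occ D y].

(* Simulation of a walk inside a single column D, whose interaction with the left
   column C is scripted by sc and whose interaction with the right column V is
   guessed: the histories of the cut on the right of D, with their weights. *)
Fixpoint outcomes (k : nat) (C D V : column) (y : nat) (sc : seq crossing) :
    seq (N * state) :=
  if k is k'.+1 then
    let up := ~~ occ D y.+1 in
    let down := below D y in
    let right := ~~ occ V y in
    let left := ~~ occ C y in
    let a := share (up + down + right + left)%N in
    [seq (N.mul a p.1, p.2) | p <-
      (if up then outcomes k' C (mark D y.+1) V y.+1 sc else [::]) ++
      (if down then outcomes k' C (mark D y.-1) V y.-1 sc else [::]) ++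
      (if right then
         [seq (p.1, (D, y, p.2))
            | p <- continuations (outcomes k' C) k' D (mark V y) sc]
       else [::]) ++
      (if left then
         (* A move to the left is accepted only as scripted: from this row, with this occupancy of
            D, and with a return to a free vertex. *)
         if sc is (W, z, z', C') :: sc' then
           if [&& W == D, z == y & ~~ occ D z']
           then outcomes k' C' (mark D z') V z' sc' else [::]
         else [::]
       else [::])]
  else [::].

(** Each recursive call of [outcomes] occupies one more row of the column, so fuel h is enough; it
    also fixes the scale 12 ^ h of the weights. *)
Definition successors (h : nat) (x : state) : seq (N * state) :=
  let: (C, y, sc) := x in
  let e := nseq h false in outcomes h C (mark e y) e y sc.

(* Bit strings, least significant bit first: rows are in unary. *)
Definition push_column (D : column) (p : positive) : positive :=
  foldr (fun b q => if b then xI q else xO q) p D.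
Definition push_row (y : nat) (p : positive) : positive := iter y xI (xO p).
Definition encode (x : state) : positive :=
  let: (D, y, t) := x in
  push_column D (push_row y (foldr (fun (c : crossing) q =>
    let: (V, y1, z, C) := c in
    push_column V (push_row y1 (push_row z (push_column C q)))) xH t)).

Fixpoint pop_column (h : nat) (p : positive) : column * positive :=
  if h is h'.+1 then
    let: (b, q) := match p with xI q => (true, q) | xO q => (false, q)
                   | xH => (false, xH) end in
    let: (D, r) := pop_column h' q in (b :: D, r)
  else ([::], p).
Fixpoint pop_row (p : positive) : nat * positive :=
  match p with
  | xI q => let: (y, r) := pop_row q in (y.+1, r)
  | xO q => (0%N, q)
  | xH => (0%N, xH)
  end.
Fixpoint pop_crossings (n h : nat) (p : positive) : seq crossing :=
  if n is n'.+1 then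
    if p is xH then [::] else
    let: (V, p1) := pop_column h p in
    let: (y, p2) := pop_row p1 in
    let: (z, p3) := pop_row p2 in
    let: (C, p4) := pop_column h p3 in
    (V, y, z, C) :: pop_crossings n' h p4
  else [::].
Definition decode (h : nat) (n : N) : state :=
  let: (D, p1) := pop_column h (if n is Npos p then p else xH) in
  let: (y, p2) := pop_row p1 in
  (D, y, pop_crossings h h p2).

Definition entry := (state * N * N)%type.

Definition entries (h : nat) (tbl : seq (N * N * N)) : seq entry :=
  [seq (decode h r.1.1, r.1.2, r.2) | r <- tbl].

Definition index_of (s : seq entry) : PositiveMap.t entry :=
  foldr (fun e M => PositiveMap.add (encode e.1.1) e M) (PositiveMap.empty _) s.

(** The stored history is compared with the requested one, so an answer is right even if two codes
    collide. *)
Definition lookup (M : PositiveMap.t entry) (x : state) : option (N * N) :=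
  if PositiveMap.find (encode x) M is Some (x', v, w) then
    if x' == x then Some (v, w) else None
  else None.

Fixpoint weighted_sums (M : PositiveMap.t entry) (s : seq (N * state)) :
    option (N * N) :=
  if s is (a, x) :: s' then
    if (lookup M x, weighted_sums M s') is (Some (v, w), Some (sv, sw)) then
      Some (N.add (N.mul a v) sv, N.add (N.mul a w) sw)
    else None
  else Some (0, 0)%num.

(* u is the common denominator of the approximate values v; the residual of v is at
   most delta / (12 ^ h * u), and w satisfies the drift inequality. *)
Definition check_state (h : nat) (u delta : N) (M : PositiveMap.t entry)
    (x : state) : bool :=
  let q := iter h (N.mul 12) 1%num in
  if (lookup M x, weighted_sums M (successors h x)) is
    (Some (v, w), Some (sv, sw)) then
    let rhs := N.add (if nilp x.2 then N.mul q u else 0%num) sv in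
    [&& (x.1.2 < h)%N, N.leb (N.mul q v) (N.add rhs delta),
        N.leb rhs (N.add (N.mul q v) delta) & N.leb (N.add sw q) (N.mul q w)]
  else false.

(** The boundary of the grid is a fully occupied column on the left of column 0: the walk has just
    crossed into row h - 1 and never returns. *)
Definition start (h : nat) : state := (nseq h true, h.-1, [::]).

Definition certified (h : nat) (u delta v0 w0 : N) (s : seq entry) : bool :=
  let M := index_of s in
  (if lookup M (start h) is Some (v, w) then N.eqb v v0 && N.eqb w w0
   else false) &&
  all (fun e : entry => check_state h u delta M e.1.1) s.

(** * Removal of the first column *)

Lemma nat_of_binD (a b : N) : nat_of_bin (N.add a b) = (a + b)%N.
Proof. lia. Qed.

Lemma nat_of_binM (a b : N) : nat_of_bin (N.mul a b) = (a * b)%N.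
Proof. lia. Qed.

Lemma leq_nat_of_bin (a b : N) : N.leb a b -> (nat_of_bin a <= nat_of_bin b)%N.
Proof. by move/N.leb_le; lia. Qed.

Lemma size_mark D y : size (mark D y) = size D.
Proof. by elim: D y => [|b D IH] [|y] //=; rewrite IH. Qed.

Lemma occ_mark D y z : occ (mark D y) z = (z == y) || occ D z.
Proof.
rewrite /occ; elim: D y z => [|b D IH] [|y] [|z] //=; rewrite ?orbT //.
by rewrite IH eqSS.
Qed.

Lemma occ_oversize D y : (size D <= y)%N -> occ D y.
Proof. by move=> h; rewrite /occ nth_default. Qed.

Lemma free_lt D y : ~~ occ D y -> (y < size D)%N.
Proof. by apply: contraNT; rewrite -leqNgt; exact: occ_oversize. Qed.

Lemma mark_occ D y z : occ D z -> occ (mark D y) z.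
Proof. by rewrite occ_mark => ->; rewrite orbT. Qed.

Definition free (D : column) : nat := count negb D.

Lemma free_mark D y : ~~ occ D y -> free D = (free (mark D y)).+1.
Proof.
rewrite /free /occ.
elim: D y => [|[] D IH] [|y] //=; rewrite ?add0n ?add1n //; first exact: IH.
by move=> /IH ->.
Qed.

Lemma col_eqP (D D' : column) : size D = size D' ->
  (forall y, occ D y = occ D' y) -> D = D'.
Proof. by move=> s e; apply: (@eq_from_nth _ true) => // i _; exact: e. Qed.

Lemma mem_supersets D W : (W \in supersets D) =
  (size W == size D) && all2 implb D W.
Proof.
elim: D W => [|b D IH] W /=; first by case: W.
have m (c : bool) s : (W \in map (cons c) s) =
    if W is d :: W' then (d == c) && (W' \in s) else false.
  case: W => [|d W]; first by apply/mapP => -[].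
  apply/mapP/andP => [[x xs [-> ->]]|[/eqP -> ws]]; first by [].
  by exists W.
case: b => /=; rewrite ?mem_cat !m.
  case: W {m} => [//|[] W] /=; rewrite ?IH ?eqSS ?andbF //.
by case: W {m} => [//|[] W] /=; rewrite IH ?eqSS //= orbF.
Qed.

Lemma supersets_uniq D : uniq (supersets D).
Proof.
elim: D => [//|b D IH] /=.
have i c : injective (cons c : column -> column) by move=> ? ? [].
case: b; rewrite ?cat_uniq !map_inj_uniq // IH /= andbT.
by apply/hasPn => W /mapP[W' _ ->]; apply/mapP => -[].
Qed.

Lemma supersetsP D W : reflect (size W = size D /\ forall y, occ D y -> occ W y)
  (W \in supersets D).
Proof.
rewrite mem_supersets /occ; apply: (iffP andP).
  move=> [/eqP s a]; split=> // y; move: s a y.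
  elim: D W => [|b D IH] [|c W] //= [s] /andP[bc a] [|y] /=; last exact: IH.
  by move/implyP: bc.
move=> [s H]; split; first exact/eqP.
elim: D W s H => [|b D IH] [|c W] //= [s] H; rewrite (IH W) // ?andbT.
  by apply/implyP; exact: (H 0).
by move=> y; exact: (H y.+1).
Qed.

(** Past the end of the list every vertex is free: the walk stops as soon as it enters the column on
    the right of the last one. *)
Fixpoint free_at (cols : seq column) (i y : nat) : bool :=
  match cols, i with
  | [::], _ => true
  | D :: _, 0 => ~~ occ D y
  | _ :: cols', i'.+1 => free_at cols' i' y
  end.

Fixpoint visit (cols : seq column) (i y : nat) : seq column :=
  match cols, i with
  | [::], _ => [::]
  | D :: cols', 0 => mark D y :: cols'
  | D :: cols', i'.+1 => D :: visit cols' i' y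
  end.

Lemma size_visit cols i y : size (visit cols i y) = size cols.
Proof. by elim: cols i => [|D cols IH] [|i] //=; rewrite IH. Qed.

Definition room (cols : seq column) : nat := \sum_(D <- cols) free D.

Lemma room_cons D cols : room (D :: cols) = (free D + room cols)%N.
Proof. by rewrite /room big_cons. Qed.

Lemma room_visit cols i y : (i < size cols)%N -> free_at cols i y ->
  room cols = (room (visit cols i y)).+1.
Proof.
elim: cols i => [//|D cols IH] [|i] /= ilt fr; rewrite !room_cons.
  by rewrite (free_mark fr) addSn.
by rewrite (IH i) // addnS.
Qed.

Definition rows (h : nat) (cols : seq column) := all (fun D => size D == h) cols.

Lemma rows_visit h cols i y : rows h (visit cols i y) = rows h cols.
Proof.
by elim: cols i => [|D cols IH] [|i] //=; rewrite ?size_mark ?IH.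
Qed.

Lemma free_at_lt h cols i y : rows h cols -> (i < size cols)%N ->
  free_at cols i y -> (y < h)%N.
Proof.
elim: cols i => [//|D cols IH] [|i] /= /andP[/eqP sD rc] ilt.
  by move=> /free_lt; rewrite sD.
exact: IH.
Qed.

Lemma occ_nil y : occ [::] y.
Proof. exact: occ_oversize. Qed.

Lemma occ_head_visit cols y : occ (head [::] (visit cols 0 y)) y.
Proof. by case: cols => [|W cols] /=; rewrite ?occ_nil // occ_mark eqxx. Qed.

Arguments occ : simpl never.

(** * Weights of walks in finitely many columns *)

Section Reach.
Variable R : realFieldType.

(* Weight of the walks that live in the columns [cols], cross into the column on
   their left only as the script dictates, and leave the last column on the right
   with the script exhausted.  C is the occupancy of the column on the left.  The
   fuel n matters only when it does not exceed [room cols]. *)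
Fixpoint reach (n : nat) (C : column) (cols : seq column) (i y : nat)
    (sc : seq crossing) : R :=
  if (size cols <= i)%N then (nilp sc)%:R else
  if n is n'.+1 then
    let up := free_at cols i y.+1 in
    let down := if y is y'.+1 then free_at cols i y' else false in
    let right := free_at cols i.+1 y in
    let left := if i is i'.+1 then free_at cols i' y else ~~ occ C y in
    (up + down + right + left)%N%:R^-1 *
    ((if up then reach n' C (visit cols i y.+1) i y.+1 sc else 0) +
     (if down then reach n' C (visit cols i y.-1) i y.-1 sc else 0) +
     (if right then reach n' C (visit cols i.+1 y) i.+1 y sc else 0) +
     (if left then
        if i is i'.+1 then reach n' C (visit cols i' y) i' y sc
        else if sc is (W, z, z', C') :: sc' then
          if [&& W == head [::] cols, z == y & ~~ occ (head [::] cols) z']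
          then reach n' C' (visit cols 0 z') 0 z' sc' else 0
        else 0
      else 0))
  else 0.

Lemma reach_exit n C cols i y sc : (size cols <= i)%N ->
  reach n C cols i y sc = (nilp sc)%:R.
Proof. by case: n => [|n] /= ->. Qed.

Lemma shareE (m : nat) : (m <= 4)%N -> (0 < m)%N ->
  (nat_of_bin (share m))%:R = 12%:R / m%:R :> R.
Proof.
case: m => [|[|[|[|[|m]]]]] // _ _;
  by apply: (canRL (mulfK _)); rewrite ?pnatr_eq0 // -natrM.
Qed.
Lemma nat_of_bin_iter (a : N) k :
  (nat_of_bin (iter k (N.mul a) 1%num))%:R = (nat_of_bin a)%:R ^+ k :> R.
Proof.
elim: k => [|k IH]; first by rewrite expr0.
by rewrite iterS nat_of_binM natrM IH exprS.
Qed.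

Lemma sum_continuations E k D Vp sc (f : seq crossing -> R) :
  \sum_(p <- continuations E k D Vp sc) (nat_of_bin p.1)%:R * f p.2 =
  (if sc is [::] then 12%:R ^+ k * f [::] else 0) +
  \sum_(y <- iota 0 (size D) | ~~ occ D y) \sum_(V <- supersets (mark Vp y))
    \sum_(p <- E (mark D y) V y sc)
      (nat_of_bin p.1)%:R * f ((V, y, p.2.1.2, p.2.1.1) :: p.2.2).
Proof.
rewrite /continuations big_cat; congr (_ + _).
  case: sc => [|c sc]; last by rewrite big_nil.
  by rewrite big_seq1 nat_of_bin_iter.
rewrite big_flatten big_map big_filter; apply: eq_bigr => y _.
rewrite big_flatten big_map; apply: eq_bigr => V _.
by rewrite big_map.
Qed.

(** Guarantees that the first crossing to the right lands on a free vertex, as the definition of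
    [reach] demands of a scripted return. *)
Lemma outcomes_free k C D V y sc p : p \in outcomes k C D V y sc ->
  ~~ occ V p.2.1.2.
Proof.
elim: k C D y sc p => [//|k IH] C D y sc p /= /mapP[q + ->] /=.
rewrite !mem_cat => /or4P[].
- by case: ifP => // _ /IH.
- by case: ifP => // _ /IH.
- by case: ifP => // fy /mapP[r _ ->].
- case: ifP => // _; case: sc => [//|[[[W z] z'] C'] sc].
  by case: ifP => // _ /IH.
Qed.

(* [peel_right] and [peel_left] say that the first column D can be summed out, when
   the walk stands to the right of D and when it stands in D; they are proved
   together by induction on the number of steps. *)
Definition peel_right n := forall n' k C D cols i y sc Vp h,
  size D = h -> rows h cols -> size Vp = h -> (y < h)%N -> (i <= size cols)%N ->
  (forall z, occ Vp z -> occ (head [::] cols) z) ->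
  (i = 0%N -> occ (head [::] cols) y) ->
  ((i < size cols)%N -> (room (D :: cols) < n)%N) ->
  ((i < size cols)%N -> (room cols < n')%N) -> (free D <= k)%N ->
  12%:R ^+ k * reach n C (D :: cols) i.+1 y sc =
  \sum_(p <- continuations (outcomes k C) k D Vp sc)
    (nat_of_bin p.1)%:R * reach n' D cols i y p.2.

Definition peel_left n := forall n' k C D cols y sc V h,
  size D = h -> rows h cols -> size V = h -> (y < h)%N ->
  (forall z, (z < h)%N -> occ V z = ~~ free_at cols 0 z) ->
  (room (D :: cols) < n)%N -> ((0 < size cols)%N -> (room cols <= n')%N) ->
  (free D < k)%N ->
  12%:R ^+ k * reach n C (D :: cols) 0 y sc =
  \sum_(p <- outcomes k C D V y sc) (nat_of_bin p.1)%:R *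
    reach n' p.2.1.1 (visit cols 0 p.2.1.2) 0 p.2.1.2 p.2.2.

(** One step from inside D: moving up, moving down or making a scripted excursion to the left fills
    another row of D, and a move to the right hands over to [peel_right]. *)
Lemma peel_leftS n : peel_right n -> peel_left n -> peel_left n.+1.
Proof.
move=> PR PL n' [//|k] C D cols y sc V h sD rc sV yh HV rn rn' fk.
rewrite [reach _ _ _ _ _ _]/= [outcomes _ _ _ _ _ _]/=.
set m := (_ + _)%N.
have -> : (~~ occ D y.+1 + below D y + ~~ occ V y + ~~ occ C y)%N = m.
  by rewrite /m HV // negbK; case: (y).
rewrite big_map.
under eq_bigr do rewrite nat_of_binM natrM -mulrA.
rewrite -mulr_sumr.
(* A trapped walk counts 0 on both sides, as [share 0] is 0 and the inverse of 0 is 0. *)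
have [m0|m0] := posnP m.
  have sh0 : share m = 0%num by rewrite m0.
  by rewrite sh0 m0 invr0 !mul0r mulr0.
have m4 : (m <= 4)%N by rewrite /m; lia.
(* One of the k + 1 factors 12 is spent on this step, the others go with the remaining fuel. *)
rewrite shareE // exprS mulrACA; congr (_ * _).
rewrite !big_cat !mulrDr -!addrA; congr (_ + (_ + (_ + _))).
- case: ifP => [fy|_]; last by rewrite big_nil mulr0.
  apply: (PL _ _ _ _ _ _ _ _ h); rewrite ?size_mark //.
  + by move: (free_lt fy); rewrite sD.
  + by move: rn; rewrite !room_cons (free_mark fy); lia.
  + by move: fk; rewrite (free_mark fy); lia.
- case: y @m yh m0 m4 => [|y] m yh m0 m4 /=; first by rewrite big_nil mulr0.
  case: ifP => [fy|_]; last by rewrite big_nil mulr0.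
  apply: (PL _ _ _ _ _ _ _ _ h); rewrite ?size_mark //.
  + by move: (free_lt fy); rewrite sD.
  + by move: rn; rewrite !room_cons (free_mark fy); lia.
  + by move: fk; rewrite (free_mark fy); lia.
- rewrite HV // negbK; case: ifP => [fy|_]; last by rewrite big_nil mulr0.
  rewrite big_map /=; apply: (PR _ _ _ _ _ _ _ _ _ h);
    rewrite ?size_mark ?rows_visit ?size_visit //.
  + move=> z; case: (cols) rc HV => [|W cols'] /=; first by rewrite occ_nil.
    move=> /andP[/eqP sW _] HV; rewrite !occ_mark => /orP[->//|oz].
    have [zh|hz] := ltnP z h; first by move: oz; rewrite HV // negbK => ->; rewrite orbT.
    by rewrite [occ W z]occ_oversize ?sW ?orbT.
  + by move=> _; exact: occ_head_visit.
  + by move=> s0; move: rn; rewrite !room_cons (room_visit s0 fy); lia.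
  + by move=> s0; move: (rn' s0); rewrite (room_visit s0 fy).
- case: ifP => // _; last by rewrite big_nil mulr0.
  case: sc => [|[[[W z] z'] C'] sc]; first by rewrite big_nil mulr0.
  case: ifP => [/and3P[_ _ fz]|_]; last by rewrite big_nil mulr0.
  apply: (PL _ _ _ _ _ _ _ _ h); rewrite ?size_mark //.
  + by move: (free_lt fz); rewrite sD.
  + by move: rn; rewrite !room_cons (free_mark fz); lia.
  + by move: fk; rewrite (free_mark fz); lia.
Qed.

(** While the walk stays to the right of D, the sum over continuations commutes with its steps by
    linearity. When it steps back into D, only the continuations that guessed this very return
    survive, and they are summed by [peel_left]. *)
Lemma peel_rightS n : (forall n0, (n0 < n)%N -> peel_right n0 /\ peel_left n0) ->
  peel_right n.
Proof.
move=> IHn n' k C D cols i y sc Vp h sD rc sVp yh ic HVp Hy rn rn' fk.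
(* Once the walk has left the last column, continuations that plan a return count 0; the one without
   return exists exactly when the script is exhausted. *)
move: ic; rewrite leq_eqVlt => /orP[/eqP ei|ic].
  rewrite reach_exit ?ei //.
  under eq_bigr do rewrite reach_exit //.
  rewrite (@sum_continuations _ _ _ _ _ (fun t => (nilp t)%:R)).
  rewrite [X in _ + X]big1 ?addr0; first by case: sc => [|c sc] /=; rewrite ?mulr0.
  by move=> z _; rewrite big1 // => V _; rewrite big1 // => p _; rewrite mulr0.
case: n IHn rn => [_ /(_ ic)//|n] /(_ n (ltnSn n))[PR PL] rn.
case: n' rn' => [/(_ ic)//|n'] /(_ ic) rn'.
rewrite [reach _ _ (_ :: _) _ _ _]/= ltnS leqNgt ic /=.
set m := (_ + _)%N.
under eq_bigr => p _.
  rewrite [reach _ _ _ _ _ _]/= leqNgt ic /=.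
  (* On the right-hand side D is the left column, and it is unchanged since the crossing, so both
     sides count the same free neighbours. *)
  rewrite -/m.
  rewrite mulrCA.
  over.
rewrite -mulr_sumr mulrCA; congr (_ * _).
under eq_bigr do rewrite !mulrDr.
rewrite !big_split /=.
have IH j z : (j <= size cols)%N -> free_at cols j z -> (z < h)%N ->
    12%:R ^+ k * reach n C (D :: visit cols j z) j.+1 z sc =
    \sum_(p <- continuations (outcomes k C) k D Vp sc)
      (nat_of_bin p.1)%:R * reach n' D (visit cols j z) j z p.2.
  move=> jc fz zh; apply: (PR _ _ _ _ _ _ _ _ _ h);
    rewrite ?rows_visit ?size_visit //.
  + move=> v /HVp; case: (cols) j {jc fz} => [|W cols'] [|j] //=; exact: mark_occ.
  + by move=> ->; exact: occ_head_visit.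
  + by move=> jc'; move: (rn ic); rewrite !room_cons (room_visit jc' fz); lia.
  + by move=> jc'; move: rn'; rewrite (room_visit jc' fz).
have upd (b : bool) j z : (b -> (j <= size cols)%N /\ free_at cols j z /\ (z < h)%N) ->
    12%:R ^+ k * (if b then reach n C (D :: visit cols j z) j.+1 z sc else 0) =
    \sum_(p <- continuations (outcomes k C) k D Vp sc)
      (nat_of_bin p.1)%:R * (if b then reach n' D (visit cols j z) j z p.2 else 0).
  case: b => [/(_ isT)[jc [fz zh]]|_]; first exact: IH.
  by rewrite mulr0 big1 // => p _; rewrite mulr0.
rewrite !mulrDr; congr (_ + _ + _ + _).
- apply: upd => fz; split; [exact: ltnW | split=> //].
  exact: (free_at_lt rc ic fz).
- apply: upd => fz; split; first exact: ltnW.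
  by case: (y) yh fz => // y' yh fz; split => //; exact: ltnW.
- by apply: upd.
- case: i ic Hy rn @m => [|i] ic Hy rn m; last first.
    by apply: (upd _ i y) => fz; split; [exact: ltnW (ltnW ic) | by split].
  case: ifP => fy; last by rewrite mulr0 big1 // => p _; rewrite mulr0.
  (* The summand of the step back into D, as a function of the guessed script: it vanishes unless
     the guess names row y and the present occupancy of the next column. *)
  pose f t : R := if t is (W, z, z', C') :: t' then
    if [&& W == head [::] cols, z == y & ~~ occ (head [::] cols) z']
    then reach n' C' (visit cols 0 z') 0 z' t' else 0 else 0.
  rewrite (@sum_continuations _ _ _ _ _ f).
  have -> : (if sc is [::] then 12%:R ^+ k * f [::] else 0) = 0.
    by case: (sc); rewrite ?mulr0.
  rewrite add0r big_mkcond (bigD1_seq y) ?iota_uniq ?mem_iota /= ?sD ?yh // fy.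
  rewrite [X in _ + X]big1 ?addr0; last first.
    move=> z zy; case: ifP => // _; rewrite big1 // => V _; rewrite big1 // => p _.
    by rewrite (negPf zy) andbF mulr0.
  have sW : size (head [::] cols) = h.
    by case: (cols) ic rc => [//|W cols'] _ /= /andP[/eqP].
  (* The present occupancy is among the guesses: rows only become occupied since the crossing, and
     the walk stands at row y. *)
  rewrite (bigD1_seq (head [::] cols)) ?supersets_uniq //=; last first.
    apply/supersetsP; rewrite size_mark sVp sW; split=> // z.
    by rewrite occ_mark => /orP[/eqP->|/HVp//]; exact: Hy.
  rewrite [X in _ + X]big1 ?addr0; last first.
    move=> V /negPf VW; rewrite big1 // => p _.
    by rewrite VW /= mulr0.
  rewrite (PL n' k C (mark D y) cols y sc (head [::] cols) h) ?size_mark //.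
  + rewrite big_seq [RHS]big_seq; apply: eq_bigr => p /outcomes_free fp.
    by rewrite !eqxx fp.
  + by case: (cols) ic => [//|W cols'] _ z _ /=; rewrite negbK.
  + by move: (rn ic); rewrite !room_cons (free_mark fy); lia.
  + by move: fk; rewrite (free_mark fy).
Qed.

Lemma peel n : peel_right n /\ peel_left n.
Proof.
have [m] := ubnP n; elim: m n => // m IH n nm.
have PR : peel_right n.
  by apply: peel_rightS => n0 n0n; apply: IH; exact: leq_trans n0n _.
split=> //; case: n nm PR => [|n] nm _.
  by move=> n' k C D cols y sc V h _ _ _ _ _; rewrite ltn0.
by have [] := IH n nm; exact: peel_leftS.
Qed.

(** For [start h] this is A_m, the probability to reach column m. The h * m vertices of the empty
    columns bound the number of steps, hence the fuel. *)
Definition value (h m : nat) (x : state) : R :=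
  let: (C, y, sc) := x in
  reach (h * m).+1 C (visit (nseq m (nseq h false)) 0 y) 0 y sc.

Lemma value0 h x : value h 0 x = (nilp x.2)%:R.
Proof. by case: x => [[C y] sc] /=. Qed.

Lemma free_empty h : free (nseq h false) = h.
Proof. by rewrite /free count_nseq mul1n. Qed.

Lemma occ_empty h y : occ (nseq h false) y = (h <= y)%N.
Proof. by rewrite /occ nth_nseq; case: ltnP. Qed.

Lemma room_empty h m : room (nseq m (nseq h false)) = (h * m)%N.
Proof.
elim: m => [|m IH]; first by rewrite /room big_nil muln0.
by rewrite /= room_cons IH free_empty mulnS.
Qed.

Lemma rows_empty h m : rows h (nseq m (nseq h false)).
Proof. by rewrite /rows all_nseq size_nseq eqxx orbT. Qed.

Lemma reach_succ h m n C y sc : (y < h)%N -> (h * m.+1 < n)%N ->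
  12%:R ^+ h * reach n C (visit (nseq m.+1 (nseq h false)) 0 y) 0 y sc =
  \sum_(p <- successors h (C, y, sc)) (nat_of_bin p.1)%:R * value h m p.2.
Proof.
move=> yh hn; have fy : ~~ occ (nseq h false) y by rewrite occ_empty -ltnNge.
have hf := free_mark fy; rewrite free_empty in hf.
rewrite [visit _ _ _]/=; have [_ PL] := peel n.
rewrite (PL (h * m).+1 h C _ _ y sc (nseq h false) h) ?size_mark ?size_nseq //.
- by apply: eq_bigr => -[a [[D z] t]] _.
- exact: rows_empty.
- by move=> z zh; case: (m) => [|m'] /=; rewrite occ_empty leqNgt zh.
- by rewrite room_cons room_empty; lia.
- by rewrite room_empty.
- by rewrite {2}hf.
Qed.

Lemma value_succ h m x : (x.1.2 < h)%N ->
  12%:R ^+ h * value h m.+1 x =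
  \sum_(p <- successors h x) (nat_of_bin p.1)%:R * value h m p.2.
Proof. by case: x => [[C y] sc] yh; exact: reach_succ. Qed.

(** For m + 1 columns both sides, scaled by 12 ^ h, are the same sum over successors, so fuel beyond
    h * m changes nothing. *)
Lemma value_stable h m n C y sc : (y < h)%N -> (h * m < n)%N ->
  reach n C (visit (nseq m (nseq h false)) 0 y) 0 y sc = value h m (C, y, sc).
Proof.
case: m => [|m] yh hn; first by rewrite /value !reach_exit.
apply: (mulfI (expf_neq0 h (_ : 12%:R != 0))); first by rewrite pnatr_eq0.
by rewrite reach_succ // value_succ.
Qed.
End Reach.

(** * Certificates *)

Lemma seq_argmax (F : realFieldType) (T : eqType) (g : T -> F) (L : seq T) x :
  x \in L -> exists2 x0, x0 \in L & forall y, y \in L -> g y <= g x0.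
Proof.
elim: L x => [//|a L IH] x _; case: L IH => [|b L] IH.
  by exists a => [|y]; rewrite ?mem_head // inE => /eqP->.
have [x0 x0L H] := IH b (mem_head _ _).
case: (leP (g a) (g x0)) => [ax|/ltW xa].
  exists x0; first by rewrite inE x0L orbT.
  by move=> y; rewrite inE => /orP[/eqP->//|]; exact: H.
exists a; first exact: mem_head.
by move=> y; rewrite inE => /orP[/eqP->//|/H yx]; exact: le_trans xa.
Qed.

(** * Linear systems controlled by a drift weight *)

Section Kernel.
Variables (T : eqType) (s : T -> seq (N * T)) (q : nat) (L : seq T).
Hypothesis L_closed : forall x, x \in L -> forall p, p \in s x -> p.2 \in L.

(** The matrix E of transition weights between histories, acting on functions; q undoes the integral
    scaling. *)
Definition avg (F : realFieldType) (f : T -> F) (x : T) : F :=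
  (\sum_(p <- s x) (nat_of_bin p.1)%:R * f p.2) / q%:R.

Lemma avg_le (F : realFieldType) (f g : T -> F) x : x \in L ->
  (forall y, y \in L -> f y <= g y) -> avg f x <= avg g x.
Proof.
move=> xL fg; apply: ler_wpM2r; first by rewrite invr_ge0 ler0n.
rewrite big_seq [leRHS]big_seq; apply: ler_sum => p ps.
by apply: ler_wpM2l; [exact: ler0n | exact: fg (L_closed xL ps)].
Qed.

Lemma avgD (F : realFieldType) (f g : T -> F) x :
  avg (fun y => f y + g y) x = avg f x + avg g x.
Proof.
by rewrite /avg -mulrDl -big_split; congr (_ / _); apply: eq_bigr => p _; rewrite mulrDr.
Qed.

Lemma avgZ (F : realFieldType) c (f : T -> F) x :
  avg (fun y => c * f y) x = c * avg f x.
Proof.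
by rewrite /avg mulrA mulr_sumr; congr (_ / _); apply: eq_bigr => p _; rewrite mulrCA.
Qed.

Lemma avgB (F : realFieldType) (f g : T -> F) x :
  avg (fun y => f y - g y) x = avg f x - avg g x.
Proof.
rewrite -mulN1r -avgZ -avgD; congr (_ / _); apply: eq_bigr => p _.
by rewrite mulN1r.
Qed.

Lemma normr_avg (F : realFieldType) (f : T -> F) x :
  `|avg f x| <= avg (fun y => `|f y|) x.
Proof.
rewrite normrM [ `|q%:R^-1| ]ger0_norm ?invr_ge0 ?ler0n //.
apply: ler_wpM2r; first by rewrite invr_ge0 ler0n.
apply: le_trans (ler_norm_sum _ _ _) _; apply: ler_sum => p _.
by rewrite normrM ger0_norm // ler0n.
Qed.

Lemma ratr_avg (F : realFieldType) (f : T -> rat) x :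
  ratr (avg f x) = avg (fun y => ratr (f y)) x :> F.
Proof.
rewrite rmorphM fmorphV rmorph_nat rmorph_sum; congr (_ / _).
by apply: eq_bigr => p _; rewrite rmorphM rmorph_nat.
Qed.

(* A weight that [avg] lowers by at least 1: it makes the iterates of [avg] decay
   geometrically and turns a residual into an error bound. *)
Variable w : T -> nat.
Definition drift (F : realFieldType) :=
  forall x, x \in L -> avg (fun y => (w y)%:R) x + 1 <= (w x)%:R :> F.

Lemma drift_ge1 (F : realFieldType) x : drift F -> x \in L -> 1 <= (w x)%:R :> F.
Proof.
move=> dr xL; apply: le_trans (dr x xL); rewrite lerDr.
by rewrite divr_ge0 // sumr_ge0 // => p _; rewrite mulr_ge0.
Qed.

(** Maximum principle: where |d| / w is largest on L, with value r, the residual and the drift give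
    r w <= delta + r (w - 1), that is r <= delta. *)
Lemma drift_bound (F : realFieldType) (delta : F) (d : T -> F) :
  drift F -> 0 <= delta ->
  (forall x, x \in L -> `|d x - avg d x| <= delta) ->
  forall x, x \in L -> `|d x| <= delta * (w x)%:R.
Proof.
move=> dr d0 H x xL.
have [x0 x0L x0P] := seq_argmax (fun y => `|d y| / (w y)%:R) xL.
set r := `|d x0| / (w x0)%:R in x0P.
have w0 y : y \in L -> 0 < (w y)%:R :> F by move=> /(drift_ge1 dr); exact: lt_le_trans.
suff rd : r <= delta.
  rewrite -ler_pdivrMr ?w0 //; exact: le_trans (x0P _ xL) rd.
rewrite leNgt; apply/negP => dlt.
have r0 : 0 <= r by apply: ltW; apply: le_lt_trans dlt.
have e0 : `|d x0| = r * (w x0)%:R by rewrite /r divfK // gt_eqF // w0.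
have h1 : `|d x0| <= delta + `|avg d x0|.
  have -> : d x0 = (d x0 - avg d x0) + avg d x0 by rewrite subrK.
  by apply: le_trans (ler_normD _ _) _; rewrite lerD2r H.
have h2 : `|avg d x0| <= r * avg (fun y => (w y)%:R) x0.
  apply: le_trans (normr_avg _ _) _; rewrite -avgZ; apply: avg_le => // y yL.
  by rewrite -ler_pdivrMr ?w0 // x0P.
have h3 : r * avg (fun y => (w y)%:R) x0 <= r * ((w x0)%:R - 1).
  by apply: ler_wpM2l => //; rewrite lerBrDr; exact: dr.
move: h1 h2 h3; rewrite e0 mulrBr mulr1; lra.
Qed.

(** If W bounds w on L, then 1 >= w / W, so the drift gives [avg] w <= (1 - 1/W) w, and |f k| <= b
    theta^k w follows by induction. *)
Lemma drift_decay (F : realFieldType) (f : nat -> T -> F) : drift F ->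
  (forall k x, x \in L -> f k.+1 x = avg (f k) x) ->
  exists B theta : F, [/\ 0 <= theta, theta < 1 &
    forall k x, x \in L -> `|f k x| <= B * theta ^+ k].
Proof.
move=> dr fS.
(* The summand 1 keeps W at least 1, hence theta nonnegative, even if L is empty. *)
pose W : F := 1 + \sum_(x <- L) (w x)%:R.
have W1 : 1 <= W by rewrite lerDl sumr_ge0.
have wW x : x \in L -> (w x)%:R <= W.
  move=> xL; rewrite /W (big_rem x) //= addrCA lerDl addr_ge0 // sumr_ge0 //.
have W0 : 0 < W by apply: lt_le_trans W1.
pose theta := 1 - W^-1; pose b := \sum_(x <- L) `|f 0%N x|.
have b0 : 0 <= b by apply: sumr_ge0.
have t0 : 0 <= theta by rewrite subr_ge0 invf_le1.
have K k x : x \in L -> `|f k x| <= b * theta ^+ k * (w x)%:R.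
  elim: k x => [|k IH] x xL.
    rewrite expr0 mulr1; apply: (@le_trans _ _ b).
      by rewrite /b (big_rem x) //= lerDl sumr_ge0.
    by rewrite ler_peMr // drift_ge1.
  rewrite fS //; apply: le_trans (normr_avg _ _) _.
  apply: le_trans (avg_le xL (g := fun y => b * theta ^+ k * (w y)%:R) _) _.
    exact: IH.
  rewrite avgZ exprSr -!mulrA; apply: ler_wpM2l => //.
  apply: ler_wpM2l; first exact: exprn_ge0.
  have := dr _ xL; have : W^-1 * (w x)%:R <= 1 by rewrite mulrC ler_pdivrMr // mul1r wW.
  rewrite /theta mulrBl mul1r; lra.
exists (b * W), theta; split=> //; first by rewrite /theta ltrBlDr ltrDl invr_gt0.
move=> k x xL; apply: le_trans (K k x xL) _.
rewrite mulrAC; apply: ler_wpM2r; first exact: exprn_ge0.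
by apply: ler_wpM2l => //; exact: wW.
Qed.

(* The drift makes [1 - avg] injective on the functions on L, hence invertible. *)
Lemma drift_solve (F : realFieldType) (u : T -> F) : drift F -> uniq L ->
  exists v : T -> F, forall x, x \in L -> v x = u x + avg v x.
Proof.
move=> dr Lu; pose n := size L.
have [L0|L0] := posnP n; first by exists u => x; rewrite (size0nil L0).
have [x0 _] : exists x0, x0 \in L.
  by move: L0; rewrite /n; case: L => [|a l] // _; exists a; exact: mem_head.
pose e (i : 'I_n) := nth x0 L i.
(* A vector indexed by L, extended by 0 outside L. *)
pose fn (z : 'rV[F]_n) y := if insub (index y L) is Some j then z 0 j else 0.
have eL i : e i \in L by apply: mem_nth.
have fnE z i : fn z (e i) = z 0 i.
  by rewrite /fn /e index_uniq // valK.
have onto y : y \in L -> exists i, y = e i.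
  by move=> yL; exists (Ordinal (etrans (index_mem y L) yL)); rewrite /e nth_index.
(* The transpose of 1 - E, since it acts on row vectors from the right. *)
pose M := \matrix_(j, i) (((i == j)%:R : F) -
  (\sum_(p <- s (e i) | p.2 == e j) (nat_of_bin p.1)%:R) / q%:R).
have ME z i : (z *m M) 0 i = fn z (e i) - avg (fn z) (e i).
  rewrite mxE; under eq_bigr do rewrite mxE mulrBr.
  rewrite sumrB; congr (_ - _).
    rewrite (bigD1 i) //= eqxx mulr1 big1 ?addr0 ?fnE // => j /negPf ji.
    by rewrite eq_sym ji mulr0.
  under eq_bigr do rewrite mulrA.
  rewrite -mulr_suml; congr (_ / _).
  under eq_bigr do rewrite big_mkcond mulr_sumr.
  rewrite exchange_big big_seq [RHS]big_seq; apply: eq_bigr => p ps /=.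
  have [j ej] := onto _ (L_closed (eL i) ps).
  rewrite (bigD1 j) //= ej eqxx fnE mulrC big1 ?addr0 // => k kj.
  rewrite nth_uniq // ifF ?mulr0 //; apply/negbTE.
  by rewrite eq_sym.
have Mu : M \in unitmx.
  rewrite -row_free_unit; apply: inj_row_free => z zM.
  apply/rowP => i; rewrite mxE -fnE.
  (* A vector in the kernel has residual 0, so [drift_bound] with delta = 0 makes it vanish. *)
  apply/eqP; rewrite -normr_le0 -(mul0r (w (e i))%:R).
  apply: drift_bound (eL i) => // x /onto[j ->].
  by rewrite -ME zM mxE normr0.
exists (fn ((\row_i u (e i)) *m invmx M)) => x /onto[i ->].
by apply/eqP; rewrite -subr_eq -ME mulmxKV // mxE.
Qed.

End Kernel.

(** * From tables to the exact rational solution *)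

Lemma find_index_of s p e :
  PositiveMap.find p (index_of s) = Some e -> e \in s.
Proof.
elim: s => [|a s IH] /=; first by rewrite PositiveMap.gempty.
case: (PositiveMap.E.eq_dec p (encode a.1.1)) => [->|ne].
  by rewrite PositiveMap.gss => -[->]; exact: mem_head.
rewrite PositiveMap.gso //.
by move=> /IH es; rewrite inE es orbT.
Qed.

Lemma lookup_mem s x r :
  lookup (index_of s) x = Some r -> x \in [seq e.1.1 | e <- s].
Proof.
rewrite /lookup; case E: (PositiveMap.find _ _) => [[[x' v] w]|//].
by case: eqP => // <- _; exact: (map_f (fun e : entry => e.1.1) (find_index_of E)).
Qed.

Section Sound.
Variable M : PositiveMap.t entry.

Definition table_v x : nat := if lookup M x is Some (v, _) then v else 0%N.
Definition table_w x : nat := if lookup M x is Some (_, w) then w else 0%N.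

(** Success also shows that every history in l is in the table, which makes the table closed under
    successors. *)
Lemma weighted_sumsP l sv sw : weighted_sums M l = Some (sv, sw) ->
  [/\ forall p, p \in l -> exists r, lookup M p.2 = Some r,
      nat_of_bin sv = (\sum_(p <- l) p.1 * table_v p.2)%N &
      nat_of_bin sw = (\sum_(p <- l) p.1 * table_w p.2)%N].
Proof.
elim: l sv sw => [|[a x] l IH] sv sw /=; first by case=> <- <-; rewrite !big_nil.
rewrite !big_cons /= /table_v /table_w.
case Ex: (lookup M x) => [[v w]|] //.
case El: (weighted_sums M l) => [[tv tw]|] // [<- <-].
have [H1 H2 H3] := IH _ _ El.
rewrite !nat_of_binD !nat_of_binM H2 H3; split=> // p.
by rewrite inE => /orP[/eqP->|]; [exists (v, w) | exact: H1].
Qed.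

End Sound.

Section Certificate.
Local Open Scope classical_set_scope.
Variables (h : nat) (u delta v0 w0 : N) (s : seq entry).
Hypothesis u0 : u <> 0%num.
Hypothesis cert : certified h u delta v0 w0 s.

Let M := index_of s.
Let L := undup [seq e.1.1 | e <- s].
Let q : nat := iter h (N.mul 12) 1%num.

Lemma stateP x : x \in L -> exists sv sw : nat,
  [/\ sv = (\sum_(p <- successors h x) p.1 * table_v M p.2)%N,
      sw = (\sum_(p <- successors h x) p.1 * table_w M p.2)%N,
      forall p, p \in successors h x -> p.2 \in L,
      (x.1.2 < h)%N &
    [/\ q * table_v M x <= nilp x.2 * (q * u) + sv + delta,
      nilp x.2 * (q * u) + sv <= q * table_v M x + delta &
      sw + q <= q * table_w M x]%N].
Proof.
rewrite mem_undup => /mapP[e es ->].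
move: cert => /andP[_ /allP /(_ _ es)]; rewrite /check_state -/M.
set y := e.1.1.
case Ey: (lookup M y) => [[v w]|] //.
case El: (weighted_sums M _) => [[sv sw]|] // /and4P[yh h1 h2 h3].
have [H1 H2 H3] := weighted_sumsP El.
exists sv, sw; split=> //.
  by move=> p /H1[r /lookup_mem]; rewrite mem_undup.
have rE : nat_of_bin (if nilp y.2 then N.mul (iter h (N.mul 12) 1%num) u else 0%num) =
    (nilp y.2 * (q * u))%N.
  by case: ifP => _; rewrite ?mul1n ?mul0n // nat_of_binM.
move: h1 h2 h3 => /leq_nat_of_bin h1 /leq_nat_of_bin h2 /leq_nat_of_bin h3.
move: h1 h2 h3; rewrite !nat_of_binD !nat_of_binM rE /table_v /table_w Ey.
by split.
Qed.

Lemma startP : [/\ start h \in L, table_v M (start h) = v0 &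
  table_w M (start h) = w0].
Proof.
move: cert => /andP[+ _]; rewrite -/M /table_v /table_w.
case E: (lookup M _) => [[v w]|] // /andP[/N.eqb_eq -> /N.eqb_eq ->].
by split=> //; rewrite mem_undup; exact: lookup_mem E.
Qed.

Lemma q_natE (F : realFieldType) : q%:R = 12%:R ^+ h :> F.
Proof. exact: nat_of_bin_iter. Qed.

Lemma q_pos (F : realFieldType) : 0 < q%:R :> F.
Proof. by rewrite q_natE exprn_gt0 // ltr0n. Qed.

Lemma certified_drift (F : realFieldType) :
  drift (successors h) q L (table_w M) F.
Proof.
move=> x /stateP[sv [sw [_ esw _ _ [_ _]]]].
rewrite -(ler_nat F) natrD natrM => H.
rewrite /avg; under eq_bigr do rewrite -natrM.
rewrite -natr_sum -esw -(ler_pM2l (q_pos F)) mulrDr mulr1 mulrCA divff ?mulr1 //.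
by rewrite gt_eqF // q_pos.
Qed.

Lemma L_closed x : x \in L -> forall p, p \in successors h x -> p.2 \in L.
Proof. by move=> /stateP[sv [sw []]]. Qed.

(** The witness is the value at the start of the exact solution v of v = u + E v over the rationals.
    Since v has residual 0, its difference with the table has the residual of the table, and
    [drift_bound] applies. *)
Lemma certified_value : exists2 r : rat,
  `|r - v0%:R / u%:R| <= delta%:R * w0%:R / (12%:R ^+ h * u%:R) &
  forall R : realType,
    (fun K : nat => \sum_(m < K) value R h m (start h)) @ \oo --> (ratr r : R).
Proof.
have un : (nat_of_bin u)%:R != 0 :> rat.
  by rewrite pnatr_eq0; apply/eqP => u00; apply: u0; lia.
have up : 0 < (nat_of_bin u)%:R :> rat by rewrite lt0r un ler0n.
have [v vP] := drift_solve L_closed (fun x => (nilp x.2)%:R)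
  (certified_drift rat) (undup_uniq _).
have [sL sv sw] := startP.
exists (v (start h)).
  rewrite -sv mulrAC -sw.
  apply: (drift_bound L_closed (d := fun x => v x - (table_v M x)%:R / u%:R)
     (certified_drift rat)) sL.
    by rewrite divr_ge0 // mulr_ge0 // ?exprn_ge0.
  move=> x xL; rewrite avgB {1}vP //.
  have [av [_ [eav _ _ _ [H1 H2 _]]]] := stateP xL.
  have -> : avg (successors h) q (fun y => (table_v M y)%:R / u%:R) x =
      av%:R / q%:R / (nat_of_bin u)%:R :> rat.
    rewrite eav natr_sum /avg mulrAC; congr (_ / _).
    by rewrite mulr_suml; apply: eq_bigr => p _; rewrite natrM mulrA.
  set A := avg _ _ _ _.
  move: H1 H2; rewrite -!(ler_nat rat) !natrD !natrM => H1 H2.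
  rewrite -q_natE.
  have -> : (nilp x.2)%:R + A - (table_v M x)%:R / u%:R - (A - av%:R / q%:R / u%:R) =
     ((nilp x.2)%:R * (q%:R * u%:R) + av%:R - q%:R * (table_v M x)%:R) / (q%:R * u%:R) :> rat.
    by field; rewrite un gt_eqF ?q_pos.
  rewrite normrM [ `|_^-1| ]ger0_norm ?invr_ge0 ?mulr_ge0 //.
  apply: ler_wpM2r; first by rewrite invr_ge0 mulr_ge0.
  by rewrite ler_norml; apply/andP; split; lra.
move=> R.
pose V x : R := ratr (v x).
have VP x : x \in L -> V x = (nilp x.2)%:R + avg (successors h) q V x.
  by move=> xL; rewrite {1}/V vP // rmorphD rmorph_nat; congr (_ + _); exact: ratr_avg.
(* The remainder of the series: f (K + 1) = E (f K) by [value_succ], so it decays geometrically. *)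
pose f K x : R := V x - \sum_(m < K) value R h m x.
have fS K x : x \in L -> f K.+1 x = avg (successors h) q (f K) x.
  move=> xL; rewrite /f big_ord_recl value0 avgB VP // opprD addrACA subrr add0r.
  congr (_ - _); rewrite /avg; apply: (canRL (mulfK _)); first by rewrite gt_eqF ?q_pos.
  rewrite mulrC mulr_sumr; under [RHS]eq_bigr do rewrite mulr_sumr.
  rewrite exchange_big; apply: eq_bigr => m _.
  have [_ [_ [_ _ _ xh _]]] := stateP xL.
  by rewrite q_natE value_succ.
have [B [theta [t0 t1 Hf]]] := drift_decay L_closed (certified_drift R) fS.
have /cvgrPdist_lt H : (fun K => B * theta ^+ K) @ \oo --> (0 : R).
  rewrite -[X in _ --> X](mulr0 B); apply: cvgMl_tmp; apply: cvg_expr.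
  by rewrite ger0_norm.
apply/cvgrPdist_lt => e /H; apply: filterS => K.
rewrite sub0r normrN; apply: le_lt_trans.
by apply: le_trans (ler_norm _); exact: Hf.
Qed.
End Certificate.

(** * Walks on the grid *)

(** Listed in the order up, down, right, left of [reach]; the bound h on the rows is left to
    [grid]. *)
Definition four_nbrs (u : Defs.point) : seq Defs.point :=
  let: (x, y) := u in
  (x, y.+1) :: (if y is y'.+1 then [:: (x, y')] else [::]) ++
  (x.+1, y) :: (if x is x'.+1 then [:: (x', y)] else [::]).

Lemma sum_sqr_eq1 (d e : int) : d * d + e * e = 1 ->
  [/\ -1 <= d <= 1, -1 <= e <= 1 & (d == 0) != (e == 0)].
Proof.
move=> de; have := sqr_ge0 d; have := sqr_ge0 e; rewrite !expr2 => e0 d0.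
have hd : -1 <= d <= 1 by apply/andP; split; nia.
have he : -1 <= e <= 1 by apply/andP; split; nia.
split=> //; move: de.
have [->|[->|->]] : d = -1 \/ d = 0 \/ d = 1 by lia.
all: by have [->|[->|->]] : e = -1 \/ e = 0 \/ e = 1 by lia.
Qed.

Lemma mem_four_nbrs u v : (v \in four_nbrs u) = (sqdist u v == 1).
Proof.
case: u v => x y [a b]; rewrite /sqdist [(x, y).1]/= [(x, y).2]/=
  [(a, b).1]/= [(a, b).2]/=.
have -> : ((a, b) \in four_nbrs (x, y)) =
    ((x == a) && ((b == y.+1) || (y == b.+1))) ||
    ((y == b) && ((a == x.+1) || (x == a.+1))).
  by case: x y => [|x] [|y]; rewrite /four_nbrs /= !inE !xpair_eqE; lia.
rewrite !expr2; apply/idP/eqP.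
  by move=> /orP[]/andP[/eqP-> /orP[]/eqP->]; rewrite -addn1 PoszD; ring.
by move=> /sum_sqr_eq1[hd he hn]; lia.
Qed.

Lemma uniq_four_nbrs u : uniq (four_nbrs u).
Proof.
by case: u => [[|x] [|y]]; rewrite /four_nbrs /= ?inE /= ?xpair_eqE; lia.
Qed.

Section Walks.
Local Open Scope classical_set_scope.
Variables (R : realType) (h : nat).

Definition width (W : seq Defs.point) : nat := (\max_(v <- W) v.1)%N.

Lemma width_rcons W v : width (rcons W v) = maxn (width W) v.1.
Proof. by rewrite /width -cats1 big_cat big_seq1. Qed.

Lemma leq_width W v : v \in W -> (v.1 <= width W)%N.
Proof. by move=> vW; exact: (leq_bigmax_seq (F := fst)). Qed.

Lemma endpoint_rcons W v : endpoint (rcons W v) = v.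
Proof. by rewrite /endpoint last_rcons. Qed.

Lemma perm_unvisited W : grid h (endpoint W) ->
  perm_eq (unvisited_nbrs h W)
    [seq v <- four_nbrs (endpoint W) | grid h v && (v \notin W)].
Proof.
move=> gW; apply: uniq_perm; try apply: filter_uniq.
- exact: nbrs_uniq.
- exact: uniq_four_nbrs.
move=> v; rewrite mem_filter mem_nbrs mem_filter mem_four_nbrs /adj gW /=.
by rewrite andbA [(v \notin W) && _]andbC.
Qed.

(* Under the uniform model, the probability that the walk started along W gets to
   column k within n further steps. *)
Fixpoint hit (n k : nat) (W : seq Defs.point) : R :=
  if (k <= width W)%N then 1 else
  if n is n'.+1 then
    \sum_(v <- unvisited_nbrs h W)
      (size (unvisited_nbrs h W))%:R^-1 * hit n' k (rcons W v)
  else 0.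

Definition column_of (x : nat) (W : seq Defs.point) : column :=
  map (fun y : nat => (x, y) \in W) (iota 0 h).

Lemma size_column_of x W : size (column_of x W) = h.
Proof. by rewrite size_map size_iota. Qed.

Definition columns_of (k : nat) (W : seq Defs.point) : seq column :=
  [seq column_of x W | x <- iota 0 k].

Lemma size_columns_of k W : size (columns_of k W) = k.
Proof. by rewrite size_map size_iota. Qed.

Lemma free_at_nth cols x y : (x < size cols)%N ->
  free_at cols x y = ~~ occ (nth [::] cols x) y.
Proof. by elim: cols x => [|D cols IH] [|x] //= /IH. Qed.

Lemma nth_columns_of k W x : (x < k)%N ->
  nth [::] (columns_of k W) x = column_of x W.
Proof. by move=> xk; rewrite (nth_map 0%N) ?size_iota // nth_iota. Qed.

Lemma occ_column W x y :
  occ (column_of x W) y = (h <= y)%N || ((x, y) \in W).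
Proof.
have [yh|hy] := ltnP y h; last by rewrite occ_oversize ?size_column_of.
by rewrite /occ (nth_map 0%N) ?size_iota // nth_iota.
Qed.

Lemma free_at_columns_of k W x y : (x < k)%N ->
  free_at (columns_of k W) x y = grid h (x, y) && ((x, y) \notin W).
Proof.
move=> xk; rewrite free_at_nth ?size_columns_of // nth_columns_of // occ_column.
by rewrite negb_or -ltnNge.
Qed.

Lemma nth_visit cols x y a :
  nth [::] (visit cols x y) a = if x == a then mark (nth [::] cols a) y else nth [::] cols a.
Proof.
elim: cols x a => [|D cols IH] [|x] [|a] //=; try by case: eqP.
by rewrite IH eqSS.
Qed.

Lemma visit_columns_of k W x y : (x < k)%N ->
  visit (columns_of k W) x y = columns_of k (rcons W (x, y)).
Proof.
move=> xk; apply: (@eq_from_nth _ [::]).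
  by rewrite size_visit !size_columns_of.
rewrite size_visit size_columns_of => a ak.
rewrite nth_visit !nth_columns_of //; apply: col_eqP.
  by case: eqP => _; rewrite ?size_mark !size_column_of.
move=> z; case: eqP => [<-|xa]; rewrite ?occ_mark !occ_column mem_rcons inE xpair_eqE.
  by rewrite eqxx /= orbCA.
by rewrite [a == x]eq_sym; case: eqP xa.
Qed.

Lemma columns_of_nil k : columns_of k [::] = nseq k (nseq h false).
Proof.
have map0 (T : Type) (f : nat -> T) (c : T) n : f =1 (fun=> c) ->
    map f (iota 0 n) = nseq n c.
  by move=> fc; rewrite (eq_map fc); elim: n 0%N => //= n IH m; rewrite IH.
by apply: (map0) => x; exact: map0.
Qed.
Lemma free_at_size cols y : free_at cols (size cols) y.
Proof. by elim: cols. Qed.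

(** Before column k is reached, the occupancies of the first k columns determine the free
    neighbours. A full column with an empty script forbids leaving on the left, and entering column
    k counts 1 on both sides. *)
Lemma hit_reach n k W x y : endpoint W = (x, y) -> (y < h)%N -> (x < k)%N ->
  (width W < k)%N ->
  hit n k W = reach R n (nseq h true) (columns_of k W) x y [::].
Proof.
elim: n W x y => [|n IH] W x y eW yh xk Wk.
  by rewrite /= leqNgt Wk size_columns_of leqNgt xk.
have gW : grid h (endpoint W) by rewrite eW.
have step a b : (b < h)%N -> (a <= k)%N ->
    hit n k (rcons W (a, b)) =
    reach R n (nseq h true) (visit (columns_of k W) a b) a b [::].
  move=> bh; rewrite leq_eqVlt => /orP[/eqP->|ak].
    rewrite reach_exit ?size_visit ?size_columns_of //=.
    by case: (n) => [|n'] /=; rewrite width_rcons leq_max leqnn orbT.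
  rewrite visit_columns_of //; apply: IH; rewrite ?endpoint_rcons //.
  by rewrite width_rcons gtn_max Wk.
rewrite [hit _ _ _]/= [reach _ _ _ _ _ _ _]/= leqNgt Wk size_columns_of leqNgt xk /=.
rewrite -mulr_sumr (perm_size (perm_unvisited gW)) (perm_big _ (perm_unvisited gW)) /=.
rewrite eW size_filter big_filter big_mkcond /=.
(* If x + 1 = k the list has ended, and the vertex in column k is indeed free because W has not
   reached that column. *)
have far : free_at (columns_of k W) x.+1 y = grid h (x.+1, y) && ((x.+1, y) \notin W).
  move: xk; rewrite leq_eqVlt => /orP[/eqP xk|xk]; last exact: free_at_columns_of.
  have -> : free_at (columns_of k W) x.+1 y.
    by rewrite xk -[X in free_at _ X](size_columns_of k W) free_at_size.
  rewrite /grid yh; apply/esym/negP => /leq_width /=; lia.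
have full : occ (nseq h true) y by rewrite /occ nth_nseq if_same.
have stepif a b : (a <= k)%N ->
    (if grid h (a, b) && ((a, b) \notin W) then hit n k (rcons W (a, b)) else 0) =
    (if grid h (a, b) && ((a, b) \notin W)
     then reach R n (nseq h true) (visit (columns_of k W) a b) a b [::] else 0).
  by case: ifP => // /andP[gb _] /(step _ _ gb).
rewrite far /four_nbrs; case: x y eW yh xk step stepif far full =>
  [|x] [|y] eW yh xk step stepif far full;
  rewrite !free_at_columns_of // ?full /= ?(ltnW xk) // ?big_cons ?big_nil ?addn0 ?addr0;
  by rewrite ?addnA !stepif ?addrA // ?(ltnW xk) // ltnW // ltnW.
Qed.
Lemma hit_ge0 n k W : 0 <= hit n k W.
Proof.
elim: n W => [|n IH] W /=; case: ifP => _ //.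
by apply: sumr_ge0 => v _; rewrite mulr_ge0 // invr_ge0.
Qed.

Lemma hit_reached n k W : (k <= width W)%N -> hit n k W = 1.
Proof. by case: n => [|n] /= ->. Qed.

Lemma trapped_nil W : trapped h W = nilp (unvisited_nbrs h W).
Proof.
rewrite /trapped /unvisited_nbrs; elim: (nbrs h _) => //= v s ->.
by case: (v \in W).
Qed.

Lemma sum_inv_size (T : Type) (s : seq T) : ~~ nilp s ->
  \sum_(v <- s) (size s)%:R^-1 = 1 :> R.
Proof.
by move=> s0; rewrite big_const_seq count_predT iter_addr_0 -[LHS]mulr_natl divff ?pnatr_eq0.
Qed.

Lemma width_le_rcons k W v : (k <= width W)%N -> (k <= width (rcons W v))%N.
Proof. by move=> kW; rewrite width_rcons leq_max kW. Qed.

(** If column k is already reached, the identity holds because the shares of the unvisited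
    neighbours add up to 1, there being at least one. *)
Lemma hitS n k W : ~~ trapped h W -> hit n.+1 k W =
  \sum_(v <- unvisited_nbrs h W)
    (size (unvisited_nbrs h W))%:R^-1 * hit n k (rcons W v).
Proof.
rewrite trapped_nil => nt /=; case: ifP => // kW; rewrite -[LHS](sum_inv_size nt).
by apply: eq_bigr => v _; rewrite hit_reached ?mulr1 // width_le_rcons.
Qed.

Lemma hit_trapped n k W : trapped h W -> (width W < k)%N -> hit n k W = 0.
Proof.
rewrite trapped_nil => /nilP e; rewrite ltnNge => /negPf Wk.
by case: n => [|n] /=; rewrite Wk // e big_nil.
Qed.

Lemma hit_incr n k W : hit n k W <= hit n.+1 k W.
Proof.
elim: n W => [|n IH] W.
  by rewrite [hit 0 _ _]/=; case: leqP => kW; rewrite ?hit_ge0 // hit_reached.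
have [kW|Wk] := leqP k (width W); first by rewrite !hit_reached.
have [tW|nt] := boolP (trapped h W); first by rewrite !hit_trapped.
rewrite hitS // [leRHS]hitS //; apply: ler_sum => v _.
by apply: ler_wpM2l; rewrite ?invr_ge0.
Qed.

Lemma hit_mono n n' k W : (n <= n')%N -> hit n k W <= hit n' k W.
Proof.
move=> /subnKC <-; elim: (n' - n)%N => [|m IH]; first by rewrite addn0.
by rewrite addnS; apply: le_trans IH (hit_incr _ _ _).
Qed.

(** * Enumeration of the growing self-avoiding walks and their weights *)

Definition weight (W : seq Defs.point) : R := uniform_weight R h W.

Lemma weight_ge0 W : 0 <= weight W.
Proof. by apply: prodr_ge0 => i _; rewrite invr_ge0. Qed.

Lemma weight1 v : weight [:: v] = 1.
Proof. by rewrite /weight /uniform_weight big_ord0. Qed.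

Lemma weight_rcons W v : W != [::] ->
  weight (rcons W v) = weight W * (size (unvisited_nbrs h W))%:R^-1.
Proof.
case: W => // a W _; rewrite /weight /uniform_weight size_rcons [_.-1]/= big_ord_recr /=.
congr (_ * _); last by rewrite -[rcons W v]cats1 take_size_cat.
apply: eq_bigr => i _; do 4 congr (_ _); congr (_ :: _).
by rewrite -cats1 takel_cat // ltnW.
Qed.

(** Bounding the number n of further steps makes the enumeration finite; every finite set of GSAWs
    extending p lies in one such list. *)
Fixpoint gsaws_extending (n : nat) (p : seq Defs.point) : seq (seq Defs.point) :=
  if trapped h p then [:: p] else
  if n is n'.+1 then
    flatten [seq gsaws_extending n' (rcons p v) | v <- unvisited_nbrs h p]
  else [::].

Definition saw (p : seq Defs.point) := [&& p != [::], walk h p & uniq p].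

Lemma saw_rcons p v : saw p -> v \in unvisited_nbrs h p -> saw (rcons p v).
Proof.
case/and3P=> p0 wp up; rewrite mem_filter mem_nbrs => /andP[vp av].
rewrite /saw rcons_uniq vp up andbT; case: p p0 wp av {up vp} => //= a p _ /andP[-> pp] av.
by rewrite rcons_path pp andbT.
Qed.

Lemma gsaws_extendingP n p W : saw p -> W \in gsaws_extending n p ->
  gsaw h W /\ exists t, W = p ++ t.
Proof.
elim: n p => [|n IH] p sp /=; case: ifP => tp.
- by rewrite inE => /eqP->; move: sp => /and3P[_ wp up]; split;
    [rewrite /gsaw wp up | exists [::]; rewrite cats0].
- by [].
- by rewrite inE => /eqP->; move: sp => /and3P[_ wp up]; split;
    [rewrite /gsaw wp up | exists [::]; rewrite cats0].
move=> /flatten_mapP[v vu /(IH _ (saw_rcons sp vu))[gW [t e]]]; split=> //.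
by exists (v :: t); rewrite e cat_rcons.
Qed.

Lemma mem_gsaws_extending n p t : p != [::] -> (size t <= n)%N ->
  gsaw h (p ++ t) -> p ++ t \in gsaws_extending n p.
Proof.
elim: n p t => [|n IH] p [|v t] p0 //= tn.
- by rewrite cats0 /gsaw => /and3P[_ _ ->]; rewrite inE.
- by rewrite cats0 /gsaw => /and3P[_ _ ->]; rewrite inE.
move=> gW; have vu : v \in unvisited_nbrs h p.
  move: gW; rewrite /gsaw => /and3P[wW uW _]; rewrite mem_filter mem_nbrs.
  move: uW; rewrite cat_uniq => /and3P[_ /= /norP[-> _] _] /=.
  by case: p p0 wW => //= a p _ /andP[_]; rewrite cat_path => /and3P[_ + _].
case: ifP => [|_]; first by rewrite trapped_nil => /nilP e; rewrite e in vu.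
apply/flatten_mapP; exists v => //; rewrite -cat_rcons.
by apply: IH => //; [case: (p) | rewrite cat_rcons].
Qed.

Lemma flatten_map_uniq (S T : eqType) (f : S -> seq T) (r : seq S) : uniq r ->
  (forall x, x \in r -> uniq (f x)) ->
  (forall x y z, x \in r -> y \in r -> z \in f x -> z \in f y -> x = y) ->
  uniq (flatten (map f r)).
Proof.
elim: r => //= a r IH /andP[ar ur] fu fd; rewrite cat_uniq fu ?mem_head //=.
rewrite IH ?andbT //.
- apply/hasPn => z /flatten_mapP[y yr zy]; apply/negP => za.
  move: ar; rewrite (fd a y z) ?yr // ?mem_head // inE yr orbT //.
- by move=> x xr; apply: fu; rewrite inE xr orbT.
- by move=> x y z xr yr; apply: fd; rewrite inE ?xr ?yr orbT.
Qed.

Lemma gsaws_extending_uniq n p : saw p -> uniq (gsaws_extending n p).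
Proof.
elim: n p => [|n IH] p sp /=; case: ifP => // _.
apply: flatten_map_uniq.
- by apply: filter_uniq; exact: nbrs_uniq.
- by move=> v vu; apply: IH; exact: saw_rcons.
move=> x y W xu yu /(gsaws_extendingP (saw_rcons sp xu))[_ [t ->]].
move=> /(gsaws_extendingP (saw_rcons sp yu))[_ [t' /eqP]].
by rewrite !cat_rcons eqseq_cat // eqxx /= => /eqP[].
Qed.

(** A walk that is trapped within n steps and has width at least k has reached column k within these
    steps. *)
Lemma sum_gsaws_le n k p : saw p ->
  \sum_(W <- gsaws_extending n p | (k <= width W)%N) weight W
    <= weight p * hit n k p.
Proof.
elim: n p => [|n IH] p sp.
  rewrite [gsaws_extending _ _]/=; case: ifP => _; last first.
    by rewrite big_nil mulr_ge0 ?weight_ge0 ?hit_ge0.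
  rewrite big_cons big_nil addr0 [hit _ _ _]/=.
  by case: ifP; rewrite ?mulr1 ?mulr0.
rewrite [gsaws_extending _ _]/=; case: ifPn => [_|nt].
  rewrite big_cons big_nil addr0; case: ifP => [kp|_].
    by rewrite hit_reached // mulr1.
  by rewrite mulr_ge0 ?weight_ge0 ?hit_ge0.
rewrite hitS // mulr_sumr big_flatten big_map big_seq [leRHS]big_seq.
apply: ler_sum => v vu; apply: le_trans (IH _ (saw_rcons sp vu)) _.
by rewrite weight_rcons ?mulrA //; case/and3P: sp.
Qed.

(** The vertices are distinct points of a box of h * k points. *)
Lemma saw_size k p : saw p -> (width p < k)%N -> (size p <= h * k)%N.
Proof.
move=> /and3P[_ wp up] pk.
have gp : all (grid h) p.
  case: p wp {up pk} => //= a p /andP[-> ].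
  by elim: p a => //= b p IH a /andP[/and3P[_ -> _] /IH].
rewrite -[h in (h * _)%N](size_iota 0) -[k in (_ * k)%N](size_iota 0) mulnC.
rewrite -(size_allpairs pair); apply: uniq_leq_size => // -[x y] v.
apply/allpairsP; exists (x, y) => /=; rewrite !mem_iota /= !add0n; split=> //.
  exact: leq_ltn_trans (leq_width v) pk.
exact: (allP gp _ v).
Qed.

(** A walk that reaches column k is either trapped within the n steps or still going after them; in
    the latter case it has more than h * K vertices, so it has reached column K by [saw_size]. *)
Lemma sum_gsaws_ge n k K p : saw p -> (k <= K)%N -> (h * K < size p + n)%N ->
  weight p * hit n k p <=
  \sum_(W <- gsaws_extending n p | (k <= width W)%N) weight W
    + weight p * hit n K p.
Proof.
move=> + kK; elim: n p => [|n IH] p sp hp.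
  have Kp : (K <= width p)%N.
    by rewrite leqNgt; apply/negP => /(saw_size sp); rewrite addn0 in hp; lia.
  rewrite !hit_reached ?(leq_trans kK) // lerDr sumr_ge0 // => W _.
  exact: weight_ge0.
rewrite [gsaws_extending _ _]/=; case: ifPn => [tp|nt].
  have [kp|pk] := leqP k (width p); last first.
    by rewrite hit_trapped // mulr0 addr_ge0 ?mulr_ge0 ?weight_ge0 ?hit_ge0 //
      sumr_ge0 // => W _; exact: weight_ge0.
  by rewrite big_cons big_nil kp addr0 hit_reached // mulr1 lerDl mulr_ge0
    ?weight_ge0 ?hit_ge0.
rewrite !hitS // !mulr_sumr big_flatten big_map -big_split big_seq [leRHS]big_seq.
apply: ler_sum => v vu /=.
have := IH _ (saw_rcons sp vu); rewrite size_rcons addSnnS => /(_ hp).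
by rewrite weight_rcons ?mulrA //; case/and3P: sp.
Qed.

(** * The expected displacement as a sum of hitting probabilities *)

Hypothesis h_gt0 : (0 < h)%N.

Definition origin : Defs.point := (0, h.-1)%N.

Lemma saw_origin : saw [:: origin].
Proof. by rewrite /saw /= /grid /= ltn_predL h_gt0. Qed.

Lemma hit_origin k n : (h * k < n)%N ->
  hit n k [:: origin] = value R h k (start h).
Proof.
move=> kn; have hh : (h.-1 < h)%N by rewrite ltn_predL.
case: k kn => [|k] kn; first by rewrite hit_reached // value0.
have w0 : width [:: origin] = 0%N by rewrite /width big_seq1.
rewrite (@hit_reach _ _ _ 0 h.-1) ?w0 //.
rewrite -[[:: origin]]/(rcons [::] origin) -visit_columns_of // columns_of_nil.
exact: value_stable.
Qed.

Lemma displacementE W v : ohead W = Some v -> v.1 = 0%N -> displacement W = width W.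
Proof.
case: W => //= a W [->] v0; rewrite /displacement -/(width _).
by rewrite (big_cons _ _ v W predT) /= v0 min0n subn0.
Qed.

Lemma sum_nat_lt M m : (\sum_(k < M) (k < m) = minn M m)%N.
Proof.
elim: M => [|M IH]; first by rewrite big_ord0 min0n.
by rewrite big_ord_recr /= IH; case: (ltnP M m) => /=; lia.
Qed.

(** Tail-sum formula for the width truncated at M; truncation keeps the sum over k finite. *)
Lemma sum_weight_width M (s : seq (seq Defs.point)) :
  \sum_(W <- s) weight W * (minn M (width W))%:R =
  \sum_(k < M) \sum_(W <- s | (k < width W)%N) weight W.
Proof.
under [RHS]eq_bigr do rewrite big_mkcond.
rewrite exchange_big; apply: eq_bigr => W _ /=.
rewrite -sum_nat_lt natr_sum mulr_sumr; apply: eq_bigr => k _.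
by case: ifP => _; rewrite ?mulr1 ?mulr0.
Qed.

Variable V : R.
Let A k : R := value R h k (start h).
Hypothesis A_sum : (fun K : nat => \sum_(k < K) A k) @ \oo --> V.

Lemma A_ge0 k : 0 <= A k.
Proof. by rewrite /A -(hit_origin (ltnSn _)) hit_ge0. Qed.

Lemma A_partial K : \sum_(k < K) A k <= V.
Proof.
rewrite -(cvg_lim _ A_sum) //; apply: nondecreasing_cvgn_le; last exact: cvgP A_sum.
move=> m n mn; rewrite -!(big_mkord xpredT A) (big_cat_nat _ mn) //= lerDl.
by apply: sumr_ge0 => k _; exact: A_ge0.
Qed.

Lemma A_cvg0 : A @ \oo --> (0 : R).
Proof.
apply: cvg_series_cvg_0; apply/cvg_ex; exists V.
by apply: cvg_trans A_sum; apply: near_eq_cvg; apply: nearW => K; rewrite /series /= big_mkord.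
Qed.

Lemma hit_origin_le n k : hit n k [:: origin] <= A k.
Proof.
rewrite /A -(@hit_origin k (maxn n (h * k).+1)) ?leq_max ?leqnn ?orbT //.
by apply: hit_mono; rewrite leq_max leqnn.
Qed.

(** A 0 = 1 because the walk starts in column 0; this is the 1 subtracted from V below. *)
Lemma A_shift K : \sum_(k < K) A k.+1 = \sum_(k < K.+1) A k - 1.
Proof. by rewrite [in RHS]big_ord_recl /A value0 addrC addKr. Qed.

Lemma mean_width_le n :
  \sum_(W <- gsaws_extending n [:: origin]) weight W * (width W)%:R <= V - 1.
Proof.
(* M bounds all widths in the list, so truncating at M loses nothing. *)
set s := gsaws_extending _ _; pose M := (\max_(W <- s) width W)%N.
rewrite big_seq; under eq_bigr => W Ws.
  have -> : width W = minn M (width W).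
    by apply/esym/minn_idPr; exact: (leq_bigmax_seq (F := width)).
  over.
rewrite -big_seq sum_weight_width.
apply: (@le_trans _ _ (\sum_(k < M) A k.+1)); last first.
  by rewrite A_shift lerD2r A_partial.
apply: ler_sum => k _; apply: le_trans (sum_gsaws_le _ _ saw_origin) _.
by rewrite weight1 mul1r hit_origin_le.
Qed.

(* Walks of width less than K are trapped within h * K steps, so what is missing has
   probability at most [A K]. *)
Lemma mean_width_ge K' K : (K' <= K)%N ->
  \sum_(k < K'.+1) A k - 1 - K'%:R * A K <=
  \sum_(W <- gsaws_extending (h * K).+1 [:: origin]) weight W * (width W)%:R.
Proof.
move=> KK; set s := gsaws_extending _ _.
apply: (@le_trans _ _ (\sum_(W <- s) weight W * (minn K' (width W))%:R)); last first.
  apply: ler_sum => W _; apply: ler_wpM2l; first exact: weight_ge0.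
  by rewrite ler_nat geq_minr.
rewrite sum_weight_width -A_shift.
have -> : K'%:R * A K = \sum_(k < K') A K by rewrite sumr_const card_ord mulr_natl.
rewrite -sumrB; apply: ler_sum => k _; rewrite lerBlDr.
have kK : (k < K)%N by apply: leq_trans (ltn_ord k) KK.
have hk : (h * k.+1 < (h * K).+1)%N by rewrite ltnS leq_mul2l kK orbT.
have := @sum_gsaws_ge (h * K).+1 k.+1 K [:: origin] saw_origin kK.
rewrite weight1 !mul1r !hit_origin // ; apply; lia.
Qed.

(** The sum over all GSAWs is a supremum over finite sets. Each of these lies in some
    [gsaws_extending], whose sum is at most V - 1 by [mean_width_le]; conversely the bounds of
    [mean_width_ge] approach V - 1. *)
Lemma expected_displacement_sum : expected_displacement R h = (V - 1)%:E.
Proof.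
pose f (W : seq Defs.point) : \bar R := (weight W * (displacement W)%:R)%:E.
have f0 W : (0 <= f W)%E by rewrite lee_fin mulr_ge0 ?weight_ge0.
rewrite /expected_displacement -/origin.
have fE W : gsaws_from h origin W -> f W = (weight W * (width W)%:R)%:E.
  by move=> [_ /displacementE e]; rewrite /f e.
have lo n : ((\sum_(W <- gsaws_extending n [:: origin])
    weight W * (width W)%:R)%:E <= \esum_(W in gsaws_from h origin) f W)%E.
  have sG W : W \in gsaws_extending n [:: origin] -> gsaws_from h origin W.
    by move=> /(gsaws_extendingP saw_origin)[gW [t e]]; split=> //; rewrite e.
  apply: esum_ge; exists [set` gsaws_extending n [:: origin]].
    by split; [exact: finite_seq | move=> W /sG].
  rewrite -fsbig_seq ?gsaws_extending_uniq ?saw_origin //.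
  rewrite -sumEFin big_seq [X in (_ <= X)%E]big_seq.
  by rewrite (eq_bigr f) // => W /sG /fE.
have hi : (\esum_(W in gsaws_from h origin) f W <= (V - 1)%:E)%E.
  apply: ge_ereal_sup => _ [X [Xfin XG] <-]; rewrite fsbig_finite //=.
  set r := finmap.enum_fset _.
  have rX W : W \in r -> gsaws_from h origin W.
    by rewrite in_fset_set // inE => /XG.
  (* With n at least the length of every walk in r, the enumeration contains all of r. *)
  pose n := (\max_(W <- r) size W)%N.
  have rn W : W \in r -> W \in gsaws_extending n [:: origin].
    move=> Wr; have [gW oW] := rX W Wr.
    case: W oW gW Wr => //= a t [->] gW Wr.
    have := @mem_gsaws_extending n [:: origin] t isT; apply => //.
    by apply: leq_trans (leqnSn _) (leq_bigmax_seq (F := size) _ Wr _).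
  have ur : uniq r by exact: finmap.fset_uniq.
  rewrite big_seq (eq_bigr (fun W => (weight W * (width W)%:R)%:E)); last first.
    by move=> W /rX /fE.
  rewrite -big_seq sumEFin lee_fin; apply: le_trans (mean_width_le n).
  set s := gsaws_extending _ _ in rn *.
  have us : uniq s by exact: gsaws_extending_uniq saw_origin.
  have -> : \sum_(W <- r) weight W * (width W)%:R =
            \sum_(W <- s | W \in r) weight W * (width W)%:R.
    rewrite -[RHS]big_filter; apply: perm_big; apply: uniq_perm; rewrite ?filter_uniq //.
    by move=> W; rewrite mem_filter; case: (boolP (W \in r)) => // /rn ->.
  rewrite [leRHS](bigID (fun W => W \in r)) /= lerDl.
  by apply: sumr_ge0 => W _; rewrite mulr_ge0 // weight_ge0.
have es0 : (0 <= \esum_(W in gsaws_from h origin) f W)%E by exact: esum_ge0.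
case E: (\esum_(W in gsaws_from h origin) f W)%E es0 hi lo => [e| |] // _ hi lo.
congr EFin; apply/eqP; rewrite eq_le -lee_fin hi /=.
rewrite lerBlDr; apply: (cvgr_to_le A_sum).
exists 1%N => // -[//|K'] _ /=; rewrite -lerBlDr.
(* Here K' is fixed and K tends to infinity, which removes [K'%:R * A K]; the limit in K' is the
   outer one. *)
have H : (fun K => \sum_(k < K'.+1) A k - 1 - K'%:R * A K) @ \oo -->
    \sum_(k < K'.+1) A k - 1 - K'%:R * 0.
  apply: cvgB; first exact: cvg_cst.
  by apply: cvgMl_tmp; exact: A_cvg0.
rewrite mulr0 subr0 in H; apply: (cvgr_to_le H).
exists K' => // K /= KK; apply: le_trans (mean_width_ge KK) _.
by rewrite -lee_fin; exact: lo.
Qed.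
End Walks.

(** * From certificates to exact and rounded values *)

Lemma nat_of_bin_neq0 (F : realFieldType) (u : N) : u <> 0%num ->
  (nat_of_bin u)%:R != 0 :> F.
Proof. by move=> u0; rewrite pnatr_eq0; apply/eqP => e; apply: u0; lia. Qed.

(** The tabulated value at the start includes the term A_0 = 1, hence the comparison of [r + 1] with
    it. *)
Lemma certified_displacement h u delta v0 w0 s : (0 < h)%N -> u <> 0%num ->
  certified h u delta v0 w0 s ->
  exists2 r : rat,
    `|r + 1 - (nat_of_bin v0)%:R / (nat_of_bin u)%:R| <=
      (nat_of_bin delta)%:R * (nat_of_bin w0)%:R /
        (12%:R ^+ h * (nat_of_bin u)%:R) &
    forall R : realType, expected_displacement R h = (ratr r)%:E.
Proof.
move=> h0 u0 cert; have [r rb rs] := certified_value u0 cert.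
exists (r - 1); first by rewrite subrK.
by move=> R; rewrite (expected_displacement_sum h0 (rs R)) rmorphB rmorph1.
Qed.

(** With residual 0 the error bound is 0; the equation between binary integers says v0 / u = n / d +
    1. *)
Lemma certified_displacement_eq h u v0 w0 s n d : (0 < h)%N -> u <> 0%num ->
  d <> 0%num -> certified h u 0 v0 w0 s -> N.mul v0 d = N.mul (N.add n d) u ->
  forall R : realType, expected_displacement R h =
    ((nat_of_bin n)%:R / (nat_of_bin d)%:R)%:E.
Proof.
move=> h0 u0 d0 cert e R; have [r + ->] := certified_displacement h0 u0 cert.
rewrite !mul0r normr_le0 subr_eq0 => /eqP re.
have un := @nat_of_bin_neq0 rat _ u0; have dn := @nat_of_bin_neq0 rat _ d0.
suff -> : r = (nat_of_bin n)%:R / (nat_of_bin d)%:R by rewrite rmorphM fmorphV !rmorph_nat.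
apply: (addIr 1); rewrite re; apply/eqP.
rewrite -[X in _ + X](divff dn) -mulrDl eqr_div //.
by rewrite -natrD -!natrM -nat_of_binD -!nat_of_binM e.
Qed.

Lemma round_dec_eq d (x : rat) (n : nat) :
  n%:R - 2^-1 <= x * 10 ^+ d < n%:R + 2^-1 -> round_dec d x = n%:R / 10 ^+ d.
Proof.
move=> /andP[lo hi]; rewrite /round_dec; congr (_ / _).
rewrite (@floor_def _ _ n%:Z) //; apply/andP; rewrite intrD; split; lra.
Qed.

(** As r + 1 is within e / (q u) of v0 / u, it suffices that the whole error interval around v0 / u
    - 1, times t = 10 ^ k, lies in [n - 1/2, n + 1/2). The two comparisons are these bounds
    multiplied by 2 q u. *)
Lemma certified_displacement_round h u delta v0 w0 s k n :
  let q := iter h (N.mul 12) 1%num in let t := iter k (N.mul 10) 1%num in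
  let e := N.mul delta w0 in
  (0 < h)%N -> u <> 0%num -> certified h u delta v0 w0 s ->
  N.leb (N.add (N.mul (N.mul 2 n) (N.mul q u))
           (N.mul (N.mul 2 t) (N.add (N.mul q u) e)))
        (N.add (N.mul (N.mul 2 t) (N.mul q v0)) (N.mul q u)) ->
  N.ltb (N.mul (N.mul 2 t) (N.add (N.mul q v0) e))
        (N.add (N.mul (N.add (N.mul 2 n) 1) (N.mul q u))
           (N.mul (N.mul 2 t) (N.mul q u))) ->
  exists r : rat,
    (forall R : realType, expected_displacement R h = (ratr r)%:E) /\
    round_dec k r = (nat_of_bin n)%:R / 10 ^+ k.
Proof.
move=> q t e h0 u0 cert lo hi.
have [r rb rE] := certified_displacement h0 u0 cert.
exists r; split=> //; apply: round_dec_eq.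
have qE : (nat_of_bin q)%:R = 12%:R ^+ h :> rat by exact: nat_of_bin_iter.
have tE : (nat_of_bin t)%:R = 10 ^+ k :> rat by exact: nat_of_bin_iter.
have eE : (nat_of_bin e)%:R = (nat_of_bin delta)%:R * (nat_of_bin w0)%:R :> rat.
  by rewrite -natrM -nat_of_binM.
have up : 0 < (nat_of_bin u)%:R :> rat by rewrite lt0r nat_of_bin_neq0 // ler0n.
have qp : 0 < (nat_of_bin q)%:R :> rat by rewrite qE exprn_gt0.
have t0 : 0 < (nat_of_bin t)%:R :> rat by rewrite tE exprn_gt0.
have {}hi : (nat_of_bin (N.mul (N.mul 2 t) (N.add (N.mul q v0) e)) <
    nat_of_bin (N.add (N.mul (N.add (N.mul 2 n) 1) (N.mul q u))
           (N.mul (N.mul 2 t) (N.mul q u))))%N by move/N.ltb_lt: hi; lia.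
move/leq_nat_of_bin: lo.
move: hi; rewrite -tE -(ltr_nat rat) -(ler_nat rat).
rewrite !(nat_of_binD, nat_of_binM, natrD, natrM).
move: rb; rewrite -eE -qE.
have -> : nat_of_bin 1 = 1%N by []. have -> : nat_of_bin 2 = 2%N by [].
move: (nat_of_bin u)%:R (nat_of_bin v0)%:R (nat_of_bin q)%:R (nat_of_bin t)%:R
  (nat_of_bin e)%:R (nat_of_bin n)%:R up qp t0 => U V Q T E M up qp t0.
have P0 : 0 < Q * U by exact: mulr_gt0.
have -> : r + 1 - V / U = (r * (Q * U) + Q * U - Q * V) / (Q * U).
  by field; rewrite !gt_eqF.
rewrite normrM [ `|_^-1| ]gtr0_norm ?invr_gt0 // ler_pM2r ?invr_gt0 // ler_norml.
move=> /andP[b1 b2] hi lo.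
have T2 : 0 < 2 * T by rewrite mulr_gt0.
rewrite -(ler_pM2l T2) in b1; rewrite -(ler_pM2l T2) in b2.
apply/andP; split.
  rewrite -(ler_pM2r P0) -(@ler_pM2l _ 2%:R) //; lra.
rewrite -(ltr_pM2r P0) -(@ltr_pM2l _ 2%:R) //; lra.
Qed.

(** * Tables *)

Section Tables.
Local Open Scope N_scope.

(* Each row is (code of a history, numerator of its value, its weight w). *)
Definition table3 : seq (N * N * N) := [::
(17,18784,13); (19,22302,16); (23,27216,21); (42,15819,11); (43,19536,13);
(46,19536,13); (92,18784,13); (94,22302,16); (95,27216,21); (62364,6048,7);
(62812,0,2); (62929,0,2); (63153,6048,7)].

Definition table4 : seq (N * N * N) := [::
(33,124344118981801037510,69); (35,146060201701444662198,85);
(39,162109249587710105832,101); (45,149448756926064518748,96);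
(47,184376086872035310144,127); (82,106280650938487056735,54);
(83,131804518336174621824,70); (86,120707470662883218666,66);
(94,140652203637680465616,84); (95,169717572377708394873,106);
(180,106280650938487056735,54); (182,120707470662883218666,66);
(183,140652203637680465616,84); (188,131804518336174621824,70);
(191,169717572377708394873,106); (376,124344118981801037510,69);
(379,149448756926064518748,96); (380,146060201701444662198,85);
(382,162109249587710105832,101); (383,184376086872035310144,127);
(379700,22086766790673396000,20); (380724,2361000894893576112,7); (381620,0,6);
(382625,0,6); (382644,0,6); (382881,0,6); (383585,25052489836780119120,23);
(383841,0,4); (510780,22086766790673396000,20);
(511804,4722001789787152224,10); (512700,0,6); (513697,0,6); (513724,0,7);
(513953,0,6); (514657,35252401474156017882,31); (514913,0,4);
(891512,3142781884688765184,9); (892536,15713909423443825920,17); (895352,0,7);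
(896376,0,6); (896801,0,7); (896929,0,6); (899681,25244587553522169688,23);
(899809,2880883394298034752,8); (1022584,3142781884688765184,9);
(1022588,3142781884688765184,9); (1023608,15713909423443825920,17);
(1023612,25189228854034148160,25); (1026424,0,8); (1026428,0,8); (1027448,0,6);
(1027452,0,6); (1027873,0,8); (1028001,0,6); (1030753,34519428161394770592,30);
(1030881,2880883394298034752,8); (1916024,25244587553522169688,23);
(1916536,2880883394298034752,8); (1927544,0,7); (1928056,0,6); (1928993,0,7);
(1929057,0,6); (1930913,3142781884688765184,9);
(1930977,15713909423443825920,17); (2047096,34519428161394770592,30);
(2047608,2880883394298034752,8); (2058616,0,8); (2059128,0,6); (2060065,0,8);
(2060067,0,8); (2060129,0,6); (2060131,0,6); (2061985,3142781884688765184,9);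
(2061987,3142781884688765184,9); (2062049,15713909423443825920,17);
(2062051,25189228854034148160,25); (3980408,25052489836780119120,23);
(3980664,0,4); (3988088,0,6); (3988344,0,6); (3989138,0,6); (3989202,0,6);
(3992978,22086766790673396000,20); (3993042,2361000894893576112,7);
(4111480,35252401474156017882,31); (4111736,0,4); (4119160,0,6); (4119416,0,6);
(4120211,0,6); (4120275,0,7); (4124051,22086766790673396000,20);
(4124115,4722001789787152224,10)].

Definition table5 : seq (N * N * N) := [::
(65,5975379353668287,379); (67,7007056453170960,472);
(71,7729513923606423,562); (77,6806122104229156,499);
(79,8284251915092271,656); (89,6601148851323572,497);
(91,7922817689110992,640); (93,7347230961707390,605);
(95,9083586122521458,810); (162,5099673231011284,296);
(163,6328693810619796,389); (166,5748286379381060,356);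
(174,6236274501528349,419); (175,7560494824928577,532);
(186,5868717427264981,402); (187,7186230794441520,516);
(190,6920713614720545,516); (191,8330017987265575,650);
(356,5113279985506678,302); (358,5804023060172582,369);
(359,6744338827931372,476); (364,5804023060172582,369);
(367,7540147544898799,576); (380,6744338827931372,476);
(382,7540147544898799,576); (383,8639052752034738,738);
(744,5099673231011284,296); (747,5868717427264981,402);
(748,5748286379381060,356); (750,6236274501528349,419);
(751,6920713614720545,516); (760,6328693810619796,389);
(763,7186230794441520,516); (766,7560494824928577,532);
(767,8330017987265575,650); (1520,5975379353668287,379);
(1523,6601148851323572,497); (1526,6806122104229156,499);
(1527,7347230961707390,605); (1528,7007056453170960,472);
(1531,7922817689110992,640); (1532,7729513923606423,562);
(1534,8284251915092271,656); (1535,9083586122521458,810);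
(2565732,1083081633231753,103); (2567780,48374717243575,16); (2569828,0,8);
(2571876,30574880930129,15); (2573668,0,18); (2575716,0,11); (2577764,0,8);
(2578753,0,18); (2579265,0,12); (2579777,0,8); (2579812,0,12); (2580289,0,13);
(2582721,1169377065884718,112); (2583233,0,8); (2583745,0,8); (2584257,0,10);
(3090028,1113656514161882,112); (3092076,72562075865362,19); (3094124,0,8);
(3096172,47136274767283,19); (3097964,0,19); (3100012,0,13); (3102060,0,8);
(3103041,0,20); (3103553,0,12); (3104065,0,8); (3104108,0,15); (3104577,0,13);
(3107009,1421670628888021,140); (3107521,0,8); (3108033,0,8); (3108545,0,10);
(4138620,1174806276022141,130); (4140668,72562075865362,19); (4142716,0,8);
(4144764,94272549534566,30); (4146556,0,22); (4148604,0,13); (4150652,0,8);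
(4151617,0,23); (4151641,0,23); (4152129,0,12); (4152153,0,14); (4152641,0,8);
(4152665,0,8); (4152700,0,21); (4153153,0,13); (4153177,0,23);
(4155585,1759732579496060,182); (4155609,1759732579496060,182); (4156097,0,8);
(4156121,0,8); (4156609,0,8); (4156633,0,8); (4157121,0,10); (4157145,0,13);
(5657832,64529603136278,19); (5659880,441410171637027,50);
(5666024,38586413075259,16); (5668072,36240240377934,14); (5673704,0,16);
(5675752,0,11); (5681896,0,13); (5683777,0,16); (5683944,0,8); (5684033,0,12);
(5684801,0,14); (5685057,0,8); (5695681,968437063118614,91);
(5695937,77800995709314,20); (5696705,0,8); (5696961,0,8);
(6182120,64529603136278,19); (6182124,64529603136278,19);
(6184168,441410171637027,50); (6184172,695148413416942,75);
(6190312,38586413075259,16); (6190316,38586413075259,16);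
(6192360,36240240377934,14); (6192364,72480480755869,19); (6197992,0,19);
(6197996,0,19); (6200040,0,11); (6200044,0,13); (6206184,0,15); (6206188,0,15);
(6208065,0,19); (6208232,0,8); (6208236,0,8); (6208321,0,12); (6209089,0,16);
(6209345,0,8); (6219969,1237121882236137,114); (6220225,77800995709314,20);
(6220993,0,8); (6221249,0,8); (7755000,64529603136278,19);
(7757048,441410171637027,50); (7763192,77172826150519,23);
(7765240,72480480755869,19); (7770872,0,16); (7772920,0,11); (7779064,0,17);
(7780929,0,16); (7781112,0,8); (7781185,0,12); (7781953,0,14); (7782209,0,8);
(7792833,1254962945147101,117); (7793089,112005642107873,26); (7793857,0,8);
(7794113,0,8); (8279288,64529603136278,19); (8281336,441410171637027,50);
(8287480,77172826150519,23); (8289528,72480480755869,19); (8295160,0,19);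
(8297208,0,11); (8303352,0,21); (8305217,0,19); (8305400,0,8); (8305473,0,12);
(8306241,0,16); (8306497,0,8); (8317121,1523647764264624,140);
(8317377,112005642107873,26); (8318145,0,8); (8318401,0,8);
(11852008,704378257632076,66); (11853032,58800935568970,17);
(11860200,64751997776562,18); (11861224,34838871213247,14); (11899624,0,16);
(11900648,0,12); (11907816,0,13); (11908840,0,11); (11909697,0,16);
(11909825,0,11); (11910721,0,14); (11910849,0,11);
(11917633,85399991445362,23); (11917761,480456196006376,55); (11918657,0,8);
(11918785,0,8); (12376296,958741115402183,87); (12377320,58800935568970,17);
(12384488,89992789034940,22); (12385512,34838871213247,14); (12423912,0,19);
(12424936,0,12); (12432104,0,15); (12433128,0,11); (12433985,0,19);
(12433987,0,19); (12434113,0,11); (12434115,0,13); (12435009,0,16);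
(12435011,0,16); (12435137,0,11); (12435139,0,12);
(12441921,85399991445362,23); (12441923,85399991445362,23);
(12442049,480456196006376,55); (12442051,770122393277821,85); (12442945,0,8);
(12442947,0,8); (12443073,0,8); (12443075,0,8); (13421040,80278750225789,27);
(13425136,49066430227234,16); (13429232,36421837871094,15);
(13433328,315905483030616,44); (13452784,0,22); (13456880,0,8);
(13460976,0,12); (13465072,0,12); (13466689,0,22); (13466945,0,8);
(13467201,0,14); (13467457,0,13); (13494465,1174057348985939,115);
(13494721,79020001463625,21); (13494977,0,8); (13495233,36448739754930,17);
(14469616,80278750225789,28); (14473712,49066430227234,16);
(14477808,36421837871094,15); (14481904,315905483030616,44); (14501360,0,27);
(14505456,0,8); (14509552,0,14); (14513648,0,12); (14515265,0,27);
(14515521,0,8); (14515777,0,16); (14516033,0,13);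
(14543041,1380253652549242,138); (14543297,79020001463625,21); (14543553,0,8);
(14543809,36448739754930,17); (15518200,80278750225789,28);
(15522296,49066430227234,16); (15526392,54632756806641,18);
(15530488,510577498095006,68); (15549944,0,26); (15554040,0,8);
(15558136,0,14); (15562232,0,14); (15563841,0,26); (15564097,0,8);
(15564353,0,14); (15564609,0,13); (15591617,1430216956225416,142);
(15591873,109852643418552,25); (15592129,0,8); (15592385,36448739754930,17);
(16046328,704378257632076,66); (16047352,58800935568970,17);
(16054520,129503995553124,28); (16055544,69677742426495,20); (16093944,0,16);
(16094968,0,12); (16102136,0,18); (16103160,0,13); (16104001,0,16);
(16104129,0,11); (16105025,0,14); (16105153,0,11);
(16111937,123645300603079,29); (16112065,678160756616717,77); (16112961,0,8);
(16113089,0,8); (16566768,80278750225789,31); (16566776,80278750225789,31);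
(16566780,80278750225789,31); (16570616,958741115402183,87);
(16570864,49066430227234,16); (16570872,49066430227234,16);
(16570876,73599645340850,20); (16571640,58800935568970,17);
(16574960,36421837871094,15); (16574968,54632756806641,18);
(16574972,54632756806641,18); (16578808,179985578069881,35);
(16579056,315905483030616,44); (16579064,510577498095006,68);
(16579068,800459918320991,103); (16579832,69677742426495,20); (16598512,0,33);
(16598520,0,33); (16598524,0,33); (16602608,0,8); (16602616,0,8);
(16602620,0,8); (16606704,0,14); (16606712,0,17); (16606716,0,17);
(16610800,0,12); (16610808,0,14); (16610812,0,17); (16612417,0,33);
(16612673,0,8); (16612929,0,16); (16613185,0,13); (16618232,0,19);
(16619256,0,12); (16626424,0,21); (16627448,0,13); (16628289,0,19);
(16628291,0,19); (16628417,0,11); (16628419,0,13); (16629313,0,16);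
(16629315,0,16); (16629441,0,11); (16629443,0,12);
(16636225,123645300603079,29); (16636227,123645300603079,29);
(16636353,678160756616717,77); (16636355,1087912679799087,120); (16637249,0,8);
(16637251,0,8); (16637377,0,8); (16637379,0,8);
(16640193,1764285593759807,181); (16640449,109852643418552,25); (16640705,0,8);
(16640961,36448739754930,17); (24303848,690969025825735,65); (24304360,0,8);
(24312040,63718885699312,18); (24312552,0,8); (24335592,0,14); (24336104,0,12);
(24343784,0,12); (24343842,0,14); (24343970,0,12); (24344296,0,11);
(24345890,0,12); (24346018,0,11); (24359714,690969025825735,65);
(24359842,63718885699312,18); (24361762,0,8); (24361890,0,8);
(24828136,972587697828363,90); (24828648,0,8); (24836328,91791005368490,22);
(24836840,0,8); (24859880,0,14); (24860392,0,12); (24868072,0,12);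
(24868131,0,14); (24868259,0,15); (24868584,0,11); (24870179,0,12);
(24870307,0,13); (24884003,690969025825735,65); (24884131,127437771398623,27);
(24886051,0,8); (24886179,0,8); (27906544,86747842501684,23);
(27908592,36897692110203,16); (27914736,483939887518628,56);
(27916784,32485659279794,13); (28001776,0,19); (28003824,0,14);
(28009968,0,12); (28012016,0,11); (28015681,0,19); (28015809,0,12);
(28016193,0,14); (28016321,0,11); (28039489,86747842501684,23);
(28039617,483939887518628,56); (28040001,36897692110203,16);
(28040129,32485659279794,13); (28955120,120156428219175,29);
(28957168,36897692110203,16); (28963312,658964288786034,73);
(28965360,32485659279794,13); (29050352,0,22); (29052400,0,14);
(29058544,0,14); (29060592,0,11); (29064257,0,22); (29064259,0,22);
(29064385,0,12); (29064387,0,14); (29064769,0,16); (29064771,0,16);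
(29064897,0,11); (29064899,0,12); (29088065,86747842501684,23);
(29088067,86747842501684,23); (29088193,483939887518628,56);
(29088195,775894932904823,86); (29088577,36897692110203,16);
(29088579,36897692110203,16); (29088705,32485659279794,13);
(29088707,48728488919691,16); (32100848,86747842501684,23);
(32100856,86747842501684,23); (32102896,36897692110203,16);
(32102904,36897692110203,16); (32109040,483939887518628,56);
(32109048,775894932904823,86); (32111088,32485659279794,13);
(32111096,48728488919691,16); (32196080,0,22); (32196088,0,22);
(32198128,0,16); (32198136,0,16); (32204272,0,12); (32204280,0,14);
(32206320,0,11); (32206328,0,12); (32209985,0,22); (32210113,0,14);
(32210497,0,14); (32210625,0,11); (32233793,120156428219175,29);
(32233921,658964288786034,73); (32234305,36897692110203,16);
(32234433,32485659279794,13); (32692472,690969025825735,65); (32692984,0,8);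
(32700664,127437771398623,27); (32701176,0,8); (32724216,0,14);
(32724728,0,12); (32732408,0,15); (32732450,0,14); (32732578,0,12);
(32732920,0,13); (32734498,0,12); (32734626,0,11);
(32748322,972587697828363,90); (32748450,91791005368490,22); (32750370,0,8);
(32750498,0,8); (33149424,120156428219175,29); (33149432,120156428219175,29);
(33151472,36897692110203,16); (33151480,36897692110203,16);
(33157616,658964288786034,73); (33157624,1056052953841625,113);
(33159664,32485659279794,13); (33159672,48728488919691,16);
(33216760,972587697828363,90); (33217272,0,8); (33224952,183582010736981,36);
(33225464,0,8); (33244656,0,25); (33244664,0,25); (33246704,0,16);
(33246712,0,16); (33248504,0,14); (33249016,0,12); (33252848,0,14);
(33252856,0,17); (33254896,0,11); (33254904,0,12); (33256696,0,15);
(33256739,0,14); (33256867,0,15); (33257208,0,13); (33258561,0,25);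
(33258563,0,25); (33258689,0,14); (33258691,0,17); (33258787,0,12);
(33258915,0,13); (33259073,0,16); (33259075,0,16); (33259201,0,11);
(33259203,0,12); (33272611,972587697828363,90); (33272739,183582010736981,36);
(33274659,0,8); (33274787,0,8); (33282369,120156428219175,29);
(33282371,120156428219175,29); (33282497,658964288786034,73);
(33282499,1056052953841625,113); (33282881,36897692110203,16);
(33282883,36897692110203,16); (33283009,32485659279794,13);
(33283011,48728488919691,16); (57004528,85399991445362,23); (57005552,0,8);
(57012720,480456196006376,55); (57013744,0,8); (57068016,0,16);
(57069040,0,14); (57076208,0,11); (57077232,0,11); (57080098,0,16);
(57080226,0,13); (57081122,0,12); (57081250,0,11);
(57127714,704378257632076,66); (57127842,64751997776562,18);
(57128738,58800935568970,17); (57128866,34838871213247,14);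
(58053104,123645300603079,29); (58054128,0,8); (58061296,678160756616717,77);
(58062320,0,8); (58116592,0,16); (58117616,0,14); (58124784,0,11);
(58125808,0,11); (58128675,0,16); (58128803,0,18); (58129699,0,12);
(58129827,0,13); (58176291,704378257632076,66); (58176419,129503995553124,28);
(58177315,58800935568970,17); (58177443,69677742426495,20);
(60023280,1174057348985939,115); (60025328,0,8); (60027376,79020001463625,21);
(60029424,36448739754930,17); (60245488,0,22); (60247536,0,14); (60249584,0,8);
(60251632,0,13); (60259393,0,22); (60259521,0,12); (60259649,0,8);
(60259777,0,12); (60275265,80278750225789,27); (60275393,36421837871094,15);
(60275521,49066430227234,16); (60275649,315905483030616,44);
(62120432,1430216956225416,142); (62122480,0,8); (62124528,109852643418552,25);
(62126576,36448739754930,17); (62342640,0,26); (62344688,0,14); (62346736,0,8);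
(62348784,0,13); (62356547,0,26); (62356675,0,14); (62356803,0,8);
(62356931,0,14); (62372419,80278750225789,28); (62372547,54632756806641,18);
(62372675,49066430227234,16); (62372803,510577498095006,68);
(64217584,1380253652549242,138); (64219632,0,8); (64221680,79020001463625,21);
(64223728,36448739754930,17); (64439792,0,27); (64441840,0,16); (64443888,0,8);
(64445936,0,13); (64453697,0,27); (64453825,0,14); (64453953,0,8);
(64454081,0,12); (64469569,80278750225789,28); (64469697,36421837871094,15);
(64469825,49066430227234,16); (64469953,315905483030616,44);
(65393136,85399991445362,23); (65393144,85399991445362,23); (65394160,0,8);
(65394168,0,8); (65401328,480456196006376,55); (65401336,770122393277821,85);
(65402352,0,8); (65402360,0,8); (65456624,0,19); (65456632,0,19);
(65457648,0,16); (65457656,0,16); (65464816,0,11); (65464824,0,13);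
(65465840,0,11); (65465848,0,12); (65468706,0,19); (65468834,0,15);
(65469730,0,12); (65469858,0,11); (65516322,958741115402183,87);
(65516450,89992789034940,22); (65517346,58800935568970,17);
(65517474,34838871213247,14); (66314736,1764285593759807,181); (66316784,0,8);
(66318832,109852643418552,25); (66320880,36448739754930,17);
(66441712,123645300603079,29); (66441720,123645300603079,29); (66442736,0,8);
(66442744,0,8); (66449904,678160756616717,77); (66449912,1087912679799087,120);
(66450928,0,8); (66450936,0,8); (66505200,0,19); (66505208,0,19);
(66506224,0,16); (66506232,0,16); (66513392,0,11); (66513400,0,13);
(66514416,0,11); (66514424,0,12); (66517283,0,19); (66517411,0,21);
(66518307,0,12); (66518435,0,13); (66536944,0,33); (66538992,0,16);
(66541040,0,8); (66543088,0,13); (66550849,0,33); (66550851,0,33);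
(66550855,0,33); (66550977,0,14); (66550979,0,17); (66550983,0,17);
(66551105,0,8); (66551107,0,8); (66551111,0,8); (66551233,0,12);
(66551235,0,14); (66551239,0,17); (66564899,958741115402183,87);
(66565027,179985578069881,35); (66565923,58800935568970,17);
(66566051,69677742426495,20); (66566721,80278750225789,31);
(66566723,80278750225789,31); (66566727,80278750225789,31);
(66566849,36421837871094,15); (66566851,54632756806641,18);
(66566855,54632756806641,18); (66566977,49066430227234,16);
(66566979,49066430227234,16); (66566983,73599645340850,20);
(66567105,315905483030616,44); (66567107,510577498095006,68);
(66567111,800459918320991,103); (122413552,968437063118614,91);
(122414576,0,8); (122417648,77800995709314,20); (122418672,0,8);
(122604016,0,16); (122605040,0,14); (122608112,0,12); (122609136,0,8);
(122616098,0,16); (122616226,0,13); (122616610,0,11); (122616738,0,8);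
(122647842,64529603136278,19); (122647970,38586413075259,16);
(122648354,441410171637027,50); (122648482,36240240377934,14);
(124510704,1254962945147101,117); (124511728,0,8);
(124514800,112005642107873,26); (124515824,0,8); (124701168,0,16);
(124702192,0,14); (124705264,0,12); (124706288,0,8); (124713251,0,16);
(124713379,0,17); (124713763,0,11); (124713891,0,8);
(124744995,64529603136278,19); (124745123,77172826150519,23);
(124745507,441410171637027,50); (124745635,72480480755869,19);
(130802160,1237121882236137,114); (130803184,0,8);
(130806256,77800995709314,20); (130807280,0,8); (130992624,0,19);
(130993648,0,16); (130996720,0,12); (130997744,0,8); (131004706,0,19);
(131004710,0,19); (131004834,0,15); (131004838,0,15); (131005218,0,11);
(131005222,0,13); (131005346,0,8); (131005350,0,8);
(131036450,64529603136278,19); (131036454,64529603136278,19);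
(131036578,38586413075259,16); (131036582,38586413075259,16);
(131036962,441410171637027,50); (131036966,695148413416942,75);
(131037090,36240240377934,14); (131037094,72480480755869,19);
(132899312,1523647764264624,140); (132900336,0,8);
(132903408,112005642107873,26); (132904432,0,8); (133089776,0,19);
(133090800,0,16); (133093872,0,12); (133094896,0,8); (133101859,0,19);
(133101987,0,21); (133102371,0,11); (133102499,0,8);
(133133603,64529603136278,19); (133133731,77172826150519,23);
(133134115,441410171637027,50); (133134243,72480480755869,19);
(253485552,1169377065884718,112); (253486576,0,8); (253487600,0,8);
(253488624,0,10); (253612528,0,18); (253613552,0,8); (253614576,0,12);
(253615600,0,13); (253621348,0,18); (253621604,0,8); (253621860,0,11);
(253622116,0,12); (253684836,1083081633231753,103); (253685092,0,8);
(253685348,48374717243575,16); (253685604,30574880930129,15);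
(261874160,1421670628888021,140); (261875184,0,8); (261876208,0,8);
(261877232,0,10); (262001136,0,20); (262002160,0,8); (262003184,0,12);
(262004208,0,13); (262009958,0,19); (262010214,0,8); (262010470,0,13);
(262010726,0,15); (262073446,1113656514161882,112); (262073702,0,8);
(262073958,72562075865362,19); (262074214,47136274767283,19);
(266068464,1759732579496060,182); (266068467,1759732579496060,182);
(266069488,0,8); (266069491,0,8); (266070512,0,8); (266070515,0,8);
(266071536,0,10); (266071539,0,13); (266195440,0,23); (266195443,0,23);
(266196464,0,8); (266196467,0,8); (266197488,0,12); (266197491,0,14);
(266198512,0,13); (266198515,0,23); (266204263,0,22); (266204519,0,8);
(266204775,0,13); (266205031,0,21); (266267751,1174806276022141,130);
(266268007,0,8); (266268263,72562075865362,19); (266268519,94272549534566,30);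
(2173104284144,421808981465100,55); (2173104286192,0,8); (2173104411120,0,10);
(2173104413168,0,8); (2173104419940,0,10); (2173104420452,0,8);
(2173104483428,61149761860259,20); (2173104483940,0,8); (2173209793008,0,10);
(2173209801200,0,8); (2173209856496,68858055388405,22); (2173209864688,0,8);
(2177265033712,0,12); (2177265034736,0,8); (2177265160688,0,10);
(2177265161712,0,8); (2177265169508,0,10); (2177265169764,0,8);
(2177265232996,0,14); (2177265233252,0,8); (2177474224624,0,12);
(2177474228720,0,8); (2177474446832,0,14); (2177474450928,0,8);
(2177474460737,0,15); (2177474460993,0,8); (2177474476609,0,10);
(2177474476865,0,8); (2177526774337,0,10); (2177526775361,0,8);
(2177526782273,0,15); (2177526783297,0,8); (2179554599408,412392607126605,51);
(2179554601456,0,8); (2179554821616,0,10); (2179554823664,0,8);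
(2179554835521,0,10); (2179554835649,0,8); (2179554851393,0,10);
(2179554851521,0,8); (2179658992112,0,10); (2179659000304,0,8);
(2179659023856,0,10); (2179659032048,0,8); (2179659037761,0,10);
(2179659038273,0,8); (2179659065537,412392607126605,51); (2179659066049,0,8);
(2180491104752,0,15); (2180491105776,0,8); (2180491168240,0,10);
(2180491169264,0,8); (2180699179504,0,10); (2180699183600,0,8);
(2180699211248,0,15); (2180699215344,0,8); (2180699225153,0,14);
(2180699225409,0,8); (2180699252929,0,12); (2180699253185,0,8);
(2180751238756,0,14); (2180751242852,0,8); (2180751246692,0,10);
(2180751250788,0,8); (2180751251777,0,10); (2180751252801,0,8);
(2180751255745,0,12); (2180751256769,0,8); (2181167430209,68858055388405,22);
(2181167430337,0,8); (2181167438145,0,10); (2181167438273,0,8);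
(2181271332452,61149761860259,20); (2181271334500,0,8); (2181271340388,0,10);
(2181271342436,0,8); (2181271345473,0,10); (2181271345985,0,8);
(2181271349441,421808981465100,55); (2181271349953,0,8)].

(** The denominator is 3112 = 8 * 389, and 27216 / 3112 - 1 = 3013 / 389. *)
Lemma certified3 : certified 3 3112 0 27216 21 (entries 3 table3).
Proof. by vm_compute. Qed.

Lemma certified4 :
  certified 4 20874575314535639327 0 184376086872035310144 127 (entries 4 table4).
Proof. by vm_compute. Qed.

(** Values with 15 decimals: the residual delta / 12 ^ 5 is below one unit of the last place, so the
    start value errs by less than w0 = 810 units, about 10 ^ -12, far less than its distance to a
    rounding border at 10 decimals. *)
Lemma certified5 :
  certified 5 1000000000000000 228096 9083586122521458 810 (entries 5 table5).
Proof. by vm_compute. Qed.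

End Tables.

(* The numerals in scope num are binary, coerced to nat. *)
Theorem mainTheorem7 (R : realType) :
  [/\ expected_displacement R 3 = (3013 / 389)%:E,
      expected_displacement R 4 =
        (163501511557499670817%num%:R / 20874575314535639327%num%:R)%:E
    & exists q : rat,
        expected_displacement R 5 = (ratr q)%:E /\
        round_dec 10 q = 80835861225%num%:R / 10 ^+ 10].
Proof.
split.
- by rewrite (certified_displacement_eq (n := 3013) (d := 389) _ _ _ certified3).
- exact: (certified_displacement_eq _ _ _ certified4).
- have [//|//|||q [qE qr]] := certified_displacement_round
    (k := 10) (n := 80835861225) _ _ certified5; [by vm_compute..|].
  exists q; split; [exact: qE | exact: qr].
Qed.
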